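(* Let $\alpha,\beta$ be two inner functions and let $A$ be a bounded linear operator from $K_\alpha$ into $K_\beta$. Then $A\in\mathscr{T}(\alpha,\beta)$ if and only if there exist $\psi\in K_\beta$ and $\chi\in K_\alpha$ such that $$A-S_\beta A S^*_\alpha=\psi\otimes k^\alpha_0+k^\beta_0\otimes\chi.$$
   Context: $H^2$ is the Hardy space of the unit disk $\mathbb{D}$, identified with a closed subspace of $L^2=L^2(\partial\mathbb{D})$ (functions whose Fourier coefficients with negative indices vanish), and $H^\infty$ is the algebra of bounded analytic functions on $\mathbb{D}$. An inner function is $\alpha\in H^\infty$ with $|\alpha|=1$ a.e. on $\partial\mathbb{D}$. The model space associated with $\alpha$ is $K_\alpha=H^2\ominus\alpha H^2$, and $P_\alpha$ is the orthogonal projection from $L^2$ onto $K_\alpha$. The set $K_\alpha^\infty=K_\alpha\cap H^\infty$ is dense in $K_\alpha$. The compressed shift $S_\alpha:K_\alpha\to K_\alpha$ is $S_\alpha f=P_\alpha(zf)$; its adjoint is $S_\alpha^*f(z)=\frac{f(z)-f(0)}{z}$. For $w\in\mathbb{D}$, the reproducing kernel of $K_\alpha$ is $k_w^\alpha(z)=\frac{1-\overline{\alpha(w)}\alpha(z)}{1-\overline{w}z}$; in particular $k_0^\alpha=1-\overline{\alpha(0)}\alpha$. For $\varphi\in L^2$, the asymmetric truncated Toeplitz operator $A_\varphi^{\alpha,\beta}$ from $K_\alpha$ into $K_\beta$ with symbol $\varphi$ is given by $A_\varphi^{\alpha,\beta}f=P_\beta(\varphi f)$; it is densely defined, on $f\in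 K_\alpha^\infty$, and is called bounded if it extends to a bounded operator $K_\alpha\to K_\beta$ (the extension is denoted by the same symbol). Then $\mathscr{T}(\alpha,\beta)=\{A_\varphi^{\alpha,\beta}:\varphi\in L^2\text{ and }A_\varphi^{\alpha,\beta}\text{ is bounded}\}$. For $x\in K_\beta$, $y\in K_\alpha$, $x\otimes y:K_\alpha\to K_\beta$ is the operator $(x\otimes y)f=\langle f,y\rangle x$, where $\langle\cdot,\cdot\rangle$ is the $L^2$ inner product. *)

(* Defs.v *)
From HB Require Import structures.
From mathcomp Require Import all_boot all_order all_algebra complex.
From mathcomp Require Import all_classical all_reals all_analysis.

Set Implicit Arguments.
Unset Strict Implicit.
Unset Printing Implicit Defensive.

Import Order.TTheory GRing.Theory Num.Theory.
Import numFieldNormedType.Exports.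
Import ComplexField.Normc.

Local Open Scope classical_set_scope.
Local Open Scope ring_scope.
Local Open Scope complex_scope.

(* A function on the unit circle is given in the angle coordinate, i.e. as
   f : R -> R[i] standing for e^{it} |-> f t with t in [0, 2 pi]; values of f
   off [0, 2 pi] are irrelevant because measurable functions that agree
   [circle_measure]-almost everywhere are not distinguished below. Classes of functions are not
   formed: equality of elements of L^2 is _ = _ %[ae circle_measure]. *)
Section HardySpace.
Variable R : realType.
Local Notation C := R[i].
Implicit Types (f g h alpha phi : R -> C).

Lemma circle_length_gt0 : (0 : R) < 2 * pi.
Proof. by rewrite mulr_gt0 ?pi_gt0. Qed.

(* normalized arc length dt / (2 pi) *)
Definition circle_measure : probability (measurableTypeR R) R :=
  uniform_prob circle_length_gt0.

(* the independent variable z = e^{it} *)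
Definition zvar (t : R) : C := cos t +i* sin t.

Definition circle_integral f : C :=
  (\int[circle_measure]_t complex.Re (f t)) +i*
  (\int[circle_measure]_t complex.Im (f t)).

Definition L2 : set (R -> C) :=
  [set f : R -> C |
    [/\ measurable_fun [set: R] (fun t => complex.Re (f t)),
        measurable_fun [set: R] (fun t => complex.Im (f t)) &
        (\int[circle_measure]_t (normc (f t) ^+ 2)%:E < +oo)%E]].

Definition inner_prod f g : C := circle_integral (fun t => f t * (g t)^*).

Definition L2norm f : R := Num.sqrt (\int[circle_measure]_t (normc (f t) ^+ 2)).

Definition fourier_coef f (n : int) : C :=
  inner_prod f (fun t => zvar t ^ n).

Definition H2 : set (R -> C) :=
  [set f : R -> C | L2 f /\ forall n : int, n < 0 -> fourier_coef f n = 0].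

(* Value at w (normc w < 1) of the analytic function on the disk which the
   identification of H^2 with a subspace of L^2 attaches to f: the Taylor
   coefficients are the Fourier coefficients of nonnegative index. *)
Definition disk_value f (w : C) : C :=
  limn (series (fun n : nat => fourier_coef f n%:Z * w ^+ n) : nat -> C^o).

Definition Hinfty : set (R -> C) :=
  [set f : R -> C | H2 f /\ exists M : R, forall w : C, normc w < 1 ->
                     normc (disk_value f w) <= M].

Definition inner_function alpha : Prop :=
  Hinfty alpha /\ {ae circle_measure, forall t, normc (alpha t) = 1}.

(* M (-) N, the vectors of M orthogonal to N *)
Definition ominus (M N : set (R -> C)) : set (R -> C) :=
  [set f : R -> C | M f /\ forall g, N g -> inner_prod f g = 0].

Definition mul_H2 alpha : set (R -> C) :=
  [set (fun t => alpha t * h t) | h in H2].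

Definition model_space alpha : set (R -> C) := ominus H2 (mul_H2 alpha).

Definition model_space_infty alpha : set (R -> C) :=
  model_space alpha `&` Hinfty.

(* orthogonal projection of L^2 onto a closed subspace M; the set below is a
   single a.e.-class, of which [xget] picks a representative *)
Definition oproj (M : set (R -> C)) f : R -> C :=
  xget (fun=> 0) [set g : R -> C | M g /\
    forall h, M h -> inner_prod (fun t => f t - g t) h = 0].

(* Hilbert space adjoint of a bounded operator T whose domain is M; same
   remark on representatives *)
Definition adjoint (M : set (R -> C)) (T : (R -> C) -> (R -> C)) g : R -> C :=
  xget (fun=> 0) [set f : R -> C | M f /\
    forall h, M h -> inner_prod (T h) g = inner_prod h f].

Definition compressed_shift alpha f : R -> C :=
  oproj (model_space alpha) (fun t => zvar t * f t).

Definition compressed_shift_adj alpha : (R -> C) -> (R -> C) :=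
  adjoint (model_space alpha) (compressed_shift alpha).

Definition model_kernel alpha (w : C) (t : R) : C :=
  (1 - (disk_value alpha w)^* * alpha t) / (1 - w^* * zvar t).

(* The operators live on all functions, but only their restriction to M is
   constrained; the second clause says that T acts on a.e.-classes. *)
Definition bounded_operator (M N : set (R -> C)) (T : (R -> C) -> (R -> C)) :=
  [/\ forall f, M f -> N (T f),
      forall f g, M f -> M g -> f = g %[ae circle_measure] ->
        T f = T g %[ae circle_measure],
      forall (c : C) f g, M f -> M g ->
        T (fun t => c * f t + g t) = (fun t => c * T f t + T g t)
          %[ae circle_measure] &
      exists B : R, forall f, M f -> L2norm (T f) <= B * L2norm f].

(* f |-> P_beta (phi f), used for f in [model_space_infty alpha] *)
Definition atto beta phi f : R -> C :=
  oproj (model_space beta) (fun t => phi t * f t).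

(* The bounded asymmetric truncated Toeplitz operators, each one being
   identified with its extension to the whole of [model_space alpha]. *)
Definition ATTO alpha beta : set ((R -> C) -> (R -> C)) :=
  [set A | bounded_operator (model_space alpha) (model_space beta) A /\
     exists2 phi, L2 phi & forall f, model_space_infty alpha f ->
       A f = atto beta phi f %[ae circle_measure]].

(* x (x) y *)
Definition rank_one (x y f : R -> C) : R -> C := fun t => inner_prod f y * x t.

End HardySpace.

Arguments circle_measure {R}.

(* Main.v *)
(* Write [z] for the variable, [S^*f = (f - f(0))/z] and [f_n] for the Taylor
   polynomials of [f] in [H^2], so that [z^n S^{*n} f = f - f_n].

   If [A = A_phi], expanding [<phi S^*f, S^*g>] for bounded [f] leaves
   [<A f, g> - <A S^*f, S^*g>
      = f(0) <phi - phi^(0), g> + <f, conj phi> conj(g(0))],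
   which is the required identity with [psi = P_beta (phi - phi^(0))] and
   [chi = P_alpha (conj phi)], first for bounded [f] and then by density.

   Conversely, telescoping [<A S^{*n}f, S^{*n}g>] along the identity gives
   [<A f, g> = <A S^{*N}f, S^{*N}g> + <psi f_N, g> + <conj chi f, g_N>]; the first
   term tends to 0 because [f_N -> f], and for bounded [f] and [g] the limit is
   [<(psi + conj chi) f, g>], so [psi + conj chi] is a symbol of [A].

   The convergence [f_N -> f] rests on the completeness of [L^2] and on the
   uniqueness of Fourier coefficients; for the latter, a function orthogonal to
   all [z^n] is orthogonal to the trigonometric polynomials
   [1 - (1 - y^n)^(2^n)] with [y] affine in [cos (t - s)], which converge
   boundedly to indicators of arcs. *)
Require Import Defs.
From mathcomp Require Import all_boot all_order all_algebra complex.
From mathcomp Require Import all_classical all_reals all_analysis.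
From mathcomp Require Import measurable_realfun zify ring lra.

Set Implicit Arguments.
Unset Strict Implicit.
Unset Printing Implicit Defensive.

Import Order.TTheory GRing.Theory Num.Theory.
Import numFieldNormedType.Exports.
Import ComplexField.Normc.

Local Open Scope classical_set_scope.
Local Open Scope complex_scope.
Local Open Scope ring_scope.

Arguments inner_prod : simpl never.
Arguments circle_integral : simpl never.

(** * Modulus, conjugation, real and imaginary parts *)

Section ComplexNumbers.
Variable R : realType.
Local Notation C := R[i].
Implicit Types z w : C.

(** [oproj] and [adjoint] pick representatives by [xget] with default 0: nothing is known of them
    before existence is proved, and afterwards only up to null sets. Identities between operators
    are therefore tested through inner products against model spaces. Existence comes from the Riesz
    projection, itself obtained as a limit of Taylor polynomials.

    A second obstacle: [Hinfty] bounds values in the disk, while a product such as [phi f] is known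
    to be in L^2 only once [f] is bounded on the circle. Truncated dilates transfer the bound to the
    circle without radial limits.

    Boundedness enters the two directions differently. Given a symbol, only [f] has to be bounded,
    and the identity extends by continuity in [f]. Given the identity, [psi f_N] may fail to
    converge in L^2, so [f_N] and [g_N] are paired with [conj(psi) g] and [conj(chi) f], which are
    square integrable for bounded [g] and [f].

    The constant term [phi^(0) f(0) conj(g(0))] would fit either rank-one operator; it is put into
    [psi]. *)

Lemma sqr_normc_sum z : normc z ^+ 2 = complex.Re z ^+ 2 + complex.Im z ^+ 2.
Proof. by case: z => a b /=; rewrite sqr_sqrtr ?addr_ge0 ?sqr_ge0. Qed.

Lemma normc_nneg z : 0 <= normc z.
Proof. by case: z => a b /=; rewrite sqrtr_ge0. Qed.

Lemma conj_pair (a b : R) : (a +i* b)^* = a -i* b :> C.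
Proof. by []. Qed.

Lemma normc_conj z : normc z^* = normc z.
Proof. by case: z => a b; rewrite conj_pair /= sqrrN. Qed.

Lemma ler_Re_normc z : `|complex.Re z| <= normc z.
Proof.
rewrite -(@ler_pXn2r _ 2) ?nnegrE ?normr_ge0 ?normc_nneg//.
by rewrite sqr_normc_sum real_normK ?num_real// lerDl sqr_ge0.
Qed.

Lemma ler_Im_normc z : `|complex.Im z| <= normc z.
Proof.
rewrite -(@ler_pXn2r _ 2) ?nnegrE ?normr_ge0 ?normc_nneg//.
by rewrite sqr_normc_sum real_normK ?num_real// lerDr sqr_ge0.
Qed.

Lemma mul_conjc z : z * z^* = (normc z ^+ 2)%:C.
Proof.
rewrite sqr_normc_sum; case: z => a b; apply/eqP; rewrite conj_pair eq_complex /=.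
by apply/andP; split; apply/eqP; ring.
Qed.

Lemma normcX z n : normc (z ^+ n) = normc z ^+ n.
Proof.
elim: n => [|n ih]; first by rewrite !expr0 normc1.
by rewrite !exprS normcM ih.
Qed.

Lemma normc_sum n (F : 'I_n -> C) :
  normc (\sum_(i < n) F i) <= \sum_(i < n) normc (F i).
Proof.
elim: n F => [|n ih] F; first by rewrite !big_ord0 normc0.
by rewrite !big_ord_recr /= (le_trans (le_normcD _ _))// lerD2r.
Qed.

Lemma normc_real (x : R) : normc x%:C = `|x|.
Proof. by rewrite /= expr0n /= addr0 sqrtr_sqr. Qed.

Lemma normcB z w : normc (z - w) <= normc z + normc w.
Proof. by rewrite (le_trans (le_normcD _ _))// normcN. Qed.

Lemma le_sqr_normcD z w :
  normc (z + w) ^+ 2 <= 2 * normc z ^+ 2 + 2 * normc w ^+ 2.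
Proof.
rewrite !sqr_normc_sum; case: z w => [a b] [c d] /=.
have := sqr_ge0 (a - c); have := sqr_ge0 (b - d); nra.
Qed.

Lemma normc_mul_le z w : normc (z * w^*) <= normc z ^+ 2 + normc w ^+ 2.
Proof.
rewrite normcM normc_conj; have := normc_nneg z; have := normc_nneg w.
move: (normc z) (normc w) => a b; have := sqr_ge0 (a - b); nra.
Qed.

Lemma ReM z w : complex.Re (z * w) =
  complex.Re z * complex.Re w - complex.Im z * complex.Im w.
Proof. by case: z w => [a b] [c d]. Qed.

Lemma ImM z w : complex.Im (z * w) =
  complex.Re z * complex.Im w + complex.Im z * complex.Re w.
Proof. by case: z w => [a b] [c d]. Qed.

Lemma ReD z w : complex.Re (z + w) = complex.Re z + complex.Re w.
Proof. by case: z w => [a b] [c d]. Qed.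

Lemma ImD z w : complex.Im (z + w) = complex.Im z + complex.Im w.
Proof. by case: z w => [a b] [c d]. Qed.

Lemma ReJ z : complex.Re z^* = complex.Re z. Proof. by case: z. Qed.
Lemma ImJ z : complex.Im z^* = - complex.Im z. Proof. by case: z. Qed.

Lemma complex_eqP z w :
  complex.Re z = complex.Re w -> complex.Im z = complex.Im w -> z = w.
Proof. by case: z w => [a b] [c d] /= -> ->. Qed.

Lemma conjCD z w : (z + w)^* = z^* + w^*. Proof. exact: rmorphD. Qed.
Lemma conjCB z w : (z - w)^* = z^* - w^*. Proof. exact: rmorphB. Qed.
Lemma conjCN z : (- z)^* = - z^*. Proof. exact: rmorphN. Qed.
Lemma conjCM z w : (z * w)^* = z^* * w^*. Proof. exact: rmorphM. Qed.
Lemma conjC_sum n (F : 'I_n -> C) :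
  (\sum_(i < n) F i)^* = \sum_(i < n) (F i)^*.
Proof. exact: rmorph_sum. Qed.
Lemma conj_real (x : R) : (x%:C)^* = x%:C :> C. Proof. exact: conjc_real. Qed.

End ComplexNumbers.

(** * Integration of complex functions against normalized arc length *)

Section ComplexIntegral.
Variable R : realType.
Local Notation C := R[i].
Local Notation mu := (@circle_measure R).

#[local] Instance circle_ae_filter : Filter (almost_everywhere mu).
Proof. exact: ae_filter_ringOfSetsType. Qed.

Lemma ae_imp (P Q : R -> Prop) : (forall t, P t -> Q t) ->
  {ae mu, forall t, P t} -> {ae mu, forall t, Q t}.
Proof. by move=> PQ; apply: filterS. Qed.

Lemma ae_imp2 (P Q S : R -> Prop) : (forall t, P t -> Q t -> S t) ->
  {ae mu, forall t, P t} -> {ae mu, forall t, Q t} -> {ae mu, forall t, S t}.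
Proof. by move=> PQ; apply: filterS2. Qed.

Lemma ae_all (P : R -> Prop) : (forall t, P t) -> {ae mu, forall t, P t}.
Proof. by move=> Pt; apply: filterE. Qed.

Implicit Types (f g h : R -> C) (c : C).

Definition cmeas f := measurable_fun [set: R] (fun t => complex.Re (f t)) /\
  measurable_fun [set: R] (fun t => complex.Im (f t)).

Definition cintegrable f :=
  mu.-integrable [set: R] (fun t => (complex.Re (f t))%:E) /\
  mu.-integrable [set: R] (fun t => (complex.Im (f t))%:E).

Lemma cmeas_cst c : cmeas (fun=> c).
Proof. by split; exact: measurable_cst. Qed.

Lemma cmeasD f g : cmeas f -> cmeas g -> cmeas (fun t => f t + g t).
Proof.
move=> [f1 f2] [g1 g2]; split; [under eq_fun do rewrite ReD|under eq_fun do rewrite ImD];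
exact: measurable_funD.
Qed.

Lemma cmeasM f g : cmeas f -> cmeas g -> cmeas (fun t => f t * g t).
Proof.
move=> [f1 f2] [g1 g2]; split;
  [under eq_fun do rewrite ReM|under eq_fun do rewrite ImM].
  by apply: measurable_funB; exact: measurable_funM.
by apply: measurable_funD; exact: measurable_funM.
Qed.

Lemma cmeasJ f : cmeas f -> cmeas (fun t => (f t)^*).
Proof.
move=> [f1 f2]; split; [under eq_fun do rewrite ReJ|under eq_fun do rewrite ImJ] => //.
exact: measurableT_comp.
Qed.

Lemma cmeas_zvar : cmeas (@zvar R).
Proof.
by split => /=; apply: continuous_measurable_fun => x;
  [exact: continuous_cos|exact: continuous_sin].
Qed.

Lemma measurable_normc f : cmeas f -> measurable_fun [set: R] (fun t => normc (f t)).
Proof.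
move=> [f1 f2].
rewrite (_ : (fun t => _) =
  (fun t => Num.sqrt (complex.Re (f t) ^+ 2 + complex.Im (f t) ^+ 2))); last first.
  by apply/funext => t; case: (f t).
apply: measurableT_comp; first exact: continuous_measurable_fun (@sqrt_continuous R).
by apply: measurable_funD; exact: measurable_funX.
Qed.

Lemma cintegrable_le f (b : R -> R) : cmeas f ->
  mu.-integrable [set: R] (EFin \o b) -> (forall t, normc (f t) <= b t) ->
  cintegrable f.
Proof.
move=> [f1 f2] ib fb; split.
  apply: le_integrable ib => //; first exact/measurable_EFinP.
  by move=> t _ /=; rewrite lee_fin (le_trans (ler_Re_normc _))// (le_trans (fb t))// ler_norm.
apply: le_integrable ib => //; first exact/measurable_EFinP.
by move=> t _ /=; rewrite lee_fin (le_trans (ler_Im_normc _))// (le_trans (fb t))// ler_norm.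
Qed.

Lemma circle_integralD f g : cintegrable f -> cintegrable g ->
  circle_integral (fun t => f t + g t) = circle_integral f + circle_integral g.
Proof.
move=> [f1 f2] [g1 g2]; rewrite /circle_integral; apply: complex_eqP => /=.
  by under eq_Rintegral do rewrite ReD; rewrite RintegralD.
by under eq_Rintegral do rewrite ImD; rewrite RintegralD.
Qed.

Lemma circle_integralZ c f : cintegrable f ->
  circle_integral (fun t => c * f t) = c * circle_integral f.
Proof.
have Zl r (g : R -> R) : mu.-integrable [set: R] (fun t => (g t)%:E) ->
    mu.-integrable [set: R] (fun t => (r * g t)%:E).
  by move=> ig; apply: (integrableZl _ r ig).
move=> [f1 f2]; rewrite /circle_integral; apply: complex_eqP => /=.
  by under eq_Rintegral do rewrite ReM; rewrite RintegralB ?RintegralZl ?ReM//; exact: Zl.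
by under eq_Rintegral do rewrite ImM; rewrite RintegralD ?RintegralZl ?ImM//; exact: Zl.
Qed.

Lemma circle_integralJ f : cintegrable f ->
  circle_integral (fun t => (f t)^*) = (circle_integral f)^*.
Proof.
move=> [f1 f2]; rewrite /circle_integral; apply: complex_eqP => /=.
  by under eq_Rintegral do rewrite ReJ.
under eq_Rintegral do rewrite ImJ -mulN1r.
by rewrite RintegralZl ?mulN1r.
Qed.

Lemma circle_integral_ae f g : cmeas f -> cmeas g -> f = g %[ae mu] ->
  circle_integral f = circle_integral g.
Proof.
move=> [f1 f2] [g1 g2] fg; rewrite /circle_integral; apply: complex_eqP => /=;
  congr fine; apply: ae_eq_integral => //; try exact/measurable_EFinP.
  by apply: ae_imp fg => t fg /fg ->.
by apply: ae_imp fg => t fg /fg ->.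
Qed.

End ComplexIntegral.

(** * Square-integrable functions on the circle *)

Section SquareIntegrable.
Variable R : realType.
Local Notation C := R[i].
Local Notation mu := (@circle_measure R).
Implicit Types (f g h : R -> C) (c : C).

Lemma L2_cmeas f : L2 f -> cmeas f.
Proof. by case. Qed.

Lemma measurable_sqr_normc f : cmeas f ->
  measurable_fun [set: R] (fun t => (normc (f t) ^+ 2)%:E).
Proof.
by move=> mf; apply/measurable_EFinP; apply: measurable_funX; exact: measurable_normc.
Qed.

Lemma L2_integrable f : L2 f ->
  mu.-integrable [set: R] (fun t => (normc (f t) ^+ 2)%:E).
Proof.
move=> fL2; have mf := L2_cmeas fL2; case: fL2 => _ _ fi.
apply/integrableP; split; first exact: measurable_sqr_normc.
by under eq_integral do rewrite gee0_abs ?lee_fin ?sqr_ge0//.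
Qed.

Lemma L2_le f (b : R -> R) : cmeas f -> mu.-integrable [set: R] (EFin \o b) ->
  {ae mu, forall t, normc (f t) ^+ 2 <= b t} -> L2 f.
Proof.
move=> mf ib fb; case: (mf) => f1 f2; split => //.
move/integrableP: ib => [mb ib]; apply: le_lt_trans ib.
apply: ae_ge0_le_integral => //=.
- by move=> t _; rewrite lee_fin sqr_ge0.
- exact: measurable_sqr_normc.
- by move/measurable_EFinP: mb => mb; apply/measurable_EFinP; exact: measurableT_comp.
by apply: ae_imp fb => t fb _; rewrite lee_fin (le_trans fb)// ler_norm.
Qed.

Lemma integrable_circle_cst (r : R) : mu.-integrable [set: R] (EFin \o (fun=> r)).
Proof. by apply: finite_measure_integrable_cst. Qed.

Lemma integrable_circleZ (r : R) (b : R -> R) :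
  mu.-integrable [set: R] (fun t => (b t)%:E) ->
  mu.-integrable [set: R] (EFin \o (fun t => r * b t)).
Proof. by move=> ib; apply: (integrableZl _ r ib). Qed.

Lemma integrable_circleD (a b : R -> R) :
  mu.-integrable [set: R] (fun t => (a t)%:E) ->
  mu.-integrable [set: R] (fun t => (b t)%:E) ->
  mu.-integrable [set: R] (EFin \o (fun t => a t + b t)).
Proof. by move=> ia ib; apply: (integrableD _ ia ib). Qed.

Lemma L2_bounded f (M : R) : cmeas f -> {ae mu, forall t, normc (f t) <= M} -> L2 f.
Proof.
move=> mf fM; apply: (L2_le (b := fun=> M ^+ 2)) => //; first exact: integrable_circle_cst.
apply: ae_imp fM => t fM; rewrite ler_pXn2r// ?nnegrE ?normc_nneg//.
by apply: le_trans fM; exact: normc_nneg.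
Qed.

Lemma L2_cst c : L2 (fun=> c).
Proof. by apply: (L2_bounded (M := normc c)); [exact: cmeas_cst|exact: ae_all]. Qed.

Lemma L2D f g : L2 f -> L2 g -> L2 (fun t => f t + g t).
Proof.
move=> fL gL.
apply: (L2_le (b := fun t => 2 * normc (f t) ^+ 2 + 2 * normc (g t) ^+ 2)).
- by apply: cmeasD; exact: L2_cmeas.
- by apply: integrable_circleD; apply: integrable_circleZ; exact: L2_integrable.
by apply: ae_all => t; exact: le_sqr_normcD.
Qed.

Lemma L2_mul_bounded b f (M : R) : cmeas b -> {ae mu, forall t, normc (b t) <= M} ->
  L2 f -> L2 (fun t => b t * f t).
Proof.
move=> mb bM fL; apply: (L2_le (b := fun t => M ^+ 2 * normc (f t) ^+ 2)).
- by apply: cmeasM => //; exact: L2_cmeas.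
- by apply: integrable_circleZ; exact: L2_integrable.
apply: ae_imp bM => t bM; rewrite normcM exprMn ler_wpM2r ?sqr_ge0//.
by rewrite ler_pXn2r// ?nnegrE ?normc_nneg// (le_trans _ bM)// normc_nneg.
Qed.

Lemma L2Z c f : L2 f -> L2 (fun t => c * f t).
Proof.
by apply: (L2_mul_bounded (M := normc c)); [exact: cmeas_cst|exact: ae_all].
Qed.

Lemma L2N f : L2 f -> L2 (fun t => - f t).
Proof. by move=> /(L2Z (-1)); under eq_fun do rewrite mulN1r. Qed.

Lemma L2B f g : L2 f -> L2 g -> L2 (fun t => f t - g t).
Proof. by move=> fL /L2N; exact: L2D. Qed.

Lemma L2J f : L2 f -> L2 (fun t => (f t)^*).
Proof.
move=> fL; apply: (L2_le (b := fun t => normc (f t) ^+ 2)).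
- by apply: cmeasJ; exact: L2_cmeas.
- exact: L2_integrable.
by apply: ae_all => t; rewrite normc_conj.
Qed.

Lemma L2_sum n (F : 'I_n -> R -> C) : (forall i, L2 (F i)) ->
  L2 (fun t => \sum_(i < n) F i t).
Proof.
elim: n F => [|n ih] F FL.
  by under eq_fun do rewrite big_ord0; exact: L2_cst.
under eq_fun do rewrite big_ord_recr /=.
by apply: L2D; [apply: ih => i|]; exact: FL.
Qed.

Lemma L2_mulJ_integrable f g : L2 f -> L2 g -> cintegrable (fun t => f t * (g t)^*).
Proof.
move=> fL gL.
apply: (cintegrable_le (b := fun t => normc (f t) ^+ 2 + normc (g t) ^+ 2)).
- by apply: cmeasM; [|apply: cmeasJ]; exact: L2_cmeas.
- by apply: integrable_circleD; exact: L2_integrable.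
by move=> t; exact: normc_mul_le.
Qed.

Lemma inner_prodDl f g h : L2 f -> L2 g -> L2 h ->
  inner_prod (fun t => f t + g t) h = inner_prod f h + inner_prod g h.
Proof.
move=> fL gL hL; rewrite /inner_prod -circle_integralD; try exact: L2_mulJ_integrable.
by congr circle_integral; apply/funext => t; rewrite mulrDl.
Qed.

Lemma inner_prodZl c f g : L2 f -> L2 g ->
  inner_prod (fun t => c * f t) g = c * inner_prod f g.
Proof.
move=> fL gL; rewrite /inner_prod -circle_integralZ; last exact: L2_mulJ_integrable.
by congr circle_integral; apply/funext => t; rewrite mulrA.
Qed.

Lemma inner_prodC f g : L2 f -> L2 g -> inner_prod g f = (inner_prod f g)^*.
Proof.
move=> fL gL; rewrite /inner_prod -circle_integralJ; last exact: L2_mulJ_integrable.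
by congr circle_integral; apply/funext => t; rewrite conjCM conjCK mulrC.
Qed.

Lemma inner_prodNl f g : L2 f -> L2 g ->
  inner_prod (fun t => - f t) g = - inner_prod f g.
Proof.
move=> fL gL; rewrite -mulN1r -inner_prodZl//; congr inner_prod.
by apply/funext => t; rewrite mulN1r.
Qed.

Lemma inner_prodBl f g h : L2 f -> L2 g -> L2 h ->
  inner_prod (fun t => f t - g t) h = inner_prod f h - inner_prod g h.
Proof.
by move=> fL gL hL; rewrite inner_prodDl// ?inner_prodNl//; exact: L2N.
Qed.

Lemma inner_prodDr f g h : L2 f -> L2 g -> L2 h ->
  inner_prod h (fun t => f t + g t) = inner_prod h f + inner_prod h g.
Proof.
move=> fL gL hL; rewrite (inner_prodC (L2D fL gL) hL) inner_prodDl// conjCD.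
by rewrite -!inner_prodC.
Qed.

Lemma inner_prodZr c f g : L2 f -> L2 g ->
  inner_prod g (fun t => c * f t) = c^* * inner_prod g f.
Proof.
by move=> fL gL; rewrite (inner_prodC (L2Z c fL) gL) inner_prodZl// conjCM -inner_prodC.
Qed.

Lemma inner_prodBr f g h : L2 f -> L2 g -> L2 h ->
  inner_prod h (fun t => f t - g t) = inner_prod h f - inner_prod h g.
Proof.
move=> fL gL hL; rewrite (inner_prodC (L2B fL gL) hL) inner_prodBl// conjCB.
by rewrite -!inner_prodC.
Qed.

Lemma inner_prod0l g : L2 g -> inner_prod (fun=> 0) g = 0.
Proof.
move=> gL; rewrite -[RHS](mul0r (inner_prod (fun=> 0) g)).
rewrite -(inner_prodZl 0 (L2_cst 0) gL).
by congr inner_prod; apply/funext => t; rewrite mul0r.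
Qed.

Lemma inner_prod0r g : L2 g -> inner_prod g (fun=> 0) = 0.
Proof.
move=> gL; rewrite (inner_prodC (L2_cst 0) gL) inner_prod0l//; exact: rmorph0.
Qed.

Lemma inner_prod_suml n (F : 'I_n -> R -> C) g : (forall i, L2 (F i)) -> L2 g ->
  inner_prod (fun t => \sum_(i < n) F i t) g = \sum_(i < n) inner_prod (F i) g.
Proof.
move=> + gL; elim: n F => [|n ih] F FL.
  by rewrite big_ord0; under eq_fun do rewrite big_ord0; exact: inner_prod0l.
rewrite big_ord_recr /= -ih//; under eq_fun do rewrite big_ord_recr /=.
by rewrite inner_prodDl//; apply: L2_sum => i; exact: FL.
Qed.

Lemma inner_prod_sumr n (F : 'I_n -> R -> C) g : (forall i, L2 (F i)) -> L2 g ->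
  inner_prod g (fun t => \sum_(i < n) F i t) = \sum_(i < n) inner_prod g (F i).
Proof.
move=> FL gL; rewrite (inner_prodC (L2_sum FL) gL) inner_prod_suml// conjC_sum.
by apply: eq_bigr => i _; rewrite -inner_prodC.
Qed.

Lemma inner_prod_ae f f' g g' : L2 f -> L2 f' -> L2 g -> L2 g' ->
  f = f' %[ae mu] -> g = g' %[ae mu] -> inner_prod f g = inner_prod f' g'.
Proof.
move=> fL f'L gL g'L ff' gg'; apply: circle_integral_ae.
- by apply: cmeasM; [|apply: cmeasJ]; exact: L2_cmeas.
- by apply: cmeasM; [|apply: cmeasJ]; exact: L2_cmeas.
by apply: ae_imp2 ff' gg' => t ff' gg' tT; rewrite ff'// gg'.
Qed.

(* Moves a multiplier across the inner product; no integrability is needed. *)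
Lemma inner_prod_mulr b f g :
  inner_prod (fun t => b t * f t) g = inner_prod f (fun t => (b t)^* * g t).
Proof.
rewrite /inner_prod; congr circle_integral; apply/funext => t.
by rewrite conjCM conjCK; ring.
Qed.

Lemma L2norm_ge0 f : 0 <= L2norm f. Proof. exact: sqrtr_ge0. Qed.

Lemma sqr_L2norm f : L2norm f ^+ 2 = \int[mu]_t (normc (f t) ^+ 2).
Proof. by rewrite sqr_sqrtr// Rintegral_ge0// => t _; exact: sqr_ge0. Qed.

Lemma inner_prod_self f : inner_prod f f = (L2norm f ^+ 2)%:C.
Proof.
rewrite sqr_L2norm /inner_prod /circle_integral; apply: complex_eqP => /=.
  by apply: eq_Rintegral => t _; rewrite mul_conjc.
rewrite (@eq_Rintegral _ _ _ _ _ (fun=> 0)); last by move=> t _; rewrite mul_conjc.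
by rewrite Rintegral_cst// mul0r.
Qed.

Lemma L2norm_eq0 f : L2 f -> L2norm f = 0 -> f = (fun=> 0) %[ae mu].
Proof.
move=> fL f0; have : (\int[mu]_t `|(normc (f t) ^+ 2)%:E| = 0)%E.
  under eq_integral do rewrite gee0_abs ?lee_fin ?sqr_ge0//.
  rewrite -[LHS]fineK; last by apply: integrable_fin_num => //; exact: L2_integrable.
  by congr EFin; rewrite -[LHS]sqr_L2norm f0 expr0n.
move/ae_eq_integral_abs => /(_ measurableT (measurable_sqr_normc (L2_cmeas fL))).
apply: ae_imp => t /(_ I) [] /eqP; rewrite expf_eq0 /= => /eqP + _.
exact: eq0_normc.
Qed.

Lemma L2norm_ae f g : L2 f -> L2 g -> f = g %[ae mu] -> L2norm f = L2norm g.
Proof.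
move=> fL gL fg; apply/eqP; rewrite -(@eqrXn2 _ 2) ?L2norm_ge0//; apply/eqP.
by apply: (@complexI R); rewrite -!inner_prod_self; exact: inner_prod_ae.
Qed.

Lemma L2normZ c f : L2 f -> L2norm (fun t => c * f t) = normc c * L2norm f.
Proof.
move=> fL; apply/eqP.
rewrite -(@eqrXn2 _ 2) ?L2norm_ge0// ?mulr_ge0 ?normc_nneg ?L2norm_ge0//.
apply/eqP; apply: (@complexI R); rewrite -inner_prod_self inner_prodZl ?inner_prodZr//;
  last exact: L2Z.
by rewrite inner_prod_self mulrA mul_conjc exprMn -rmorphM.
Qed.

Lemma L2normN f : L2 f -> L2norm (fun t => - f t) = L2norm f.
Proof.
move=> fL; rewrite (_ : (fun t => _) = fun t => -1 * f t).
  by rewrite L2normZ// normcN normc1 mul1r.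
by apply/funext => t; rewrite mulN1r.
Qed.

Lemma sqr_L2normD f g : L2 f -> L2 g -> L2norm (fun t => f t + g t) ^+ 2 =
  L2norm f ^+ 2 + 2 * complex.Re (inner_prod f g) + L2norm g ^+ 2.
Proof.
move=> fL gL; apply: (@complexI R); rewrite -inner_prod_self inner_prodDl ?inner_prodDr//;
  try exact: L2D.
rewrite !inner_prod_self (inner_prodC fL gL).
case: (inner_prod f g) => a b; apply: complex_eqP => /=; first ring.
by rewrite addr0 add0r; ring.
Qed.

Lemma cauchy_schwarz f g : L2 f -> L2 g ->
  normc (inner_prod f g) <= L2norm f * L2norm g.
Proof.
move=> fL gL; set c := inner_prod f g.
have [g0|gneq0] := eqVneq (L2norm g) 0.
  rewrite /c (inner_prod_ae (g' := fun=> 0) fL fL gL (L2_cst 0))//.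
  - by rewrite inner_prod0r// normc0 mulr_ge0 ?L2norm_ge0.
  - exact: ae_all.
  - exact: L2norm_eq0.
have g_gt0 : 0 < L2norm g by rewrite lt_def gneq0 L2norm_ge0.
(* [s g] is the projection of [f] on the line spanned by [g]; the inequality is the nonnegativity of
   [||f - s g||^2]. *)
pose s : C := c * ((L2norm g ^+ 2)^-1)%:C.
have : 0 <= L2norm (fun t => f t + - s * g t) ^+ 2 by exact: sqr_ge0.
rewrite sqr_L2normD//; last exact: L2Z.
rewrite inner_prodZr// -/c L2normZ// normcN.
have -> : (- s)^* * c = (- (normc c ^+ 2 / L2norm g ^+ 2))%:C.
  rewrite /s conjCN conjCM conj_real mulNr mulrAC (mulrC c^*) mul_conjc.
  by rewrite -rmorphM -rmorphN.
have -> : normc s = normc c * normc ((L2norm g ^+ 2)^-1)%:C by exact: normcM.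
rewrite normc_real ger0_norm ?invr_ge0 ?sqr_ge0//; clearbody c.
move: (normc_nneg c) (L2norm_ge0 f) g_gt0.
move: (normc c) (L2norm f) (L2norm g) => x a b x0 a0 b0.
have -> : (x * (b ^+ 2)^-1 * b) ^+ 2 = x ^+ 2 / b ^+ 2.
  by field; rewrite gt_eqF.
move=> /= h; have : x ^+ 2 / b ^+ 2 <= a ^+ 2 by move: h; set y := x ^+ 2 / b ^+ 2; lra.
rewrite ler_pdivrMr ?exprn_gt0// -exprMn ler_pXn2r// nnegrE//.
by rewrite mulr_ge0// ltW.
Qed.

Lemma L2normD f g : L2 f -> L2 g ->
  L2norm (fun t => f t + g t) <= L2norm f + L2norm g.
Proof.
move=> fL gL; rewrite -(@ler_pXn2r _ 2) ?nnegrE ?L2norm_ge0 ?addr_ge0 ?L2norm_ge0//.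
rewrite sqr_L2normD// sqrrD lerD2r lerD2l.
have := le_trans (ler_norm _) (le_trans (ler_Re_normc (inner_prod f g)) (cauchy_schwarz fL gL)).
by rewrite mulr2n; lra.
Qed.

Lemma L2normB f g : L2 f -> L2 g ->
  L2norm (fun t => f t - g t) <= L2norm f + L2norm g.
Proof.
move=> fL gL; rewrite -(L2normN gL); apply: L2normD => //; exact: L2N.
Qed.

Lemma L2norm_distC f g : L2 f -> L2 g ->
  L2norm (fun t => f t - g t) = L2norm (fun t => g t - f t).
Proof.
move=> fL gL; rewrite -L2normN; last exact: L2B.
by congr L2norm; apply/funext => t; rewrite opprB.
Qed.

Lemma L2norm_triangle f g h : L2 f -> L2 g -> L2 h ->
  L2norm (fun t => f t - h t) <=
  L2norm (fun t => f t - g t) + L2norm (fun t => g t - h t).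
Proof.
move=> fL gL hL; rewrite (_ : (fun t => f t - h t) =
  (fun t => (f t - g t) + (g t - h t))); first by apply: L2normD; exact: L2B.
by apply/funext => t; ring.
Qed.

Lemma L2norm_mul_unimodular b f : cmeas b -> {ae mu, forall t, normc (b t) = 1} ->
  L2 f -> L2norm (fun t => b t * f t) = L2norm f.
Proof.
move=> mb b1 fL.
have bfL : L2 (fun t => b t * f t).
  by apply: (L2_mul_bounded (M := 1)) => //; apply: ae_imp b1 => t ->.
apply/eqP; rewrite -(@eqrXn2 _ 2) ?L2norm_ge0//; apply/eqP; apply: (@complexI R).
rewrite -!inner_prod_self /inner_prod.
apply: circle_integral_ae; try by apply: cmeasM; [|apply: cmeasJ]; exact: L2_cmeas.
by apply: ae_imp b1 => t b1 _; rewrite !mul_conjc normcM b1 mul1r.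
Qed.

End SquareIntegrable.

(** * Completeness of L2 *)

Section Completeness.
Context d (T : measurableType d) (R : realType).
Variable P : probability T R.

(* AM-GM trades the L^1 norm of the increments for their L^2 norm. *)
Lemma L1_le_sqr (v : T -> R) (e : R) : measurable_fun [set: T] v -> 0 < e ->
  (\int[P]_t (v t ^+ 2)%:E <= (e ^+ 2)%:E)%E -> (\int[P]_t `|v t|%:E <= e%:E)%E.
Proof.
move=> mv e0 ve.
have mv2 : measurable_fun [set: T] (fun t => (v t ^+ 2)%:E).
  by apply/measurable_EFinP; exact: measurable_funX.
apply: (@le_trans _ _ (\int[P]_t ((e / 2)%:E + (2 * e)^-1%:E * (v t ^+ 2)%:E))%E).
  apply: ge0_le_integral => //.
  - by apply/measurable_EFinP; exact: measurableT_comp.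
  - by apply: emeasurable_funD => //; exact: measurable_funeM.
  move=> t _; rewrite -EFinM -EFinD lee_fin.
  have -> : e / 2 + (2 * e)^-1 * v t ^+ 2 = (e ^+ 2 + v t ^+ 2) / (2 * e).
    by field; rewrite gt_eqF.
  rewrite ler_pdivlMr ?mulr_gt0// -[v t ^+ 2]real_normK ?num_real//.
  have := sqr_ge0 (e - `|v t|); lra.
rewrite ge0_integralD//; last 3 first.
- by move=> t _; rewrite lee_fin; lra.
- by move=> t _; rewrite -EFinM lee_fin mulr_ge0 ?invr_ge0 ?sqr_ge0//; lra.
- exact: measurable_funeM.
rewrite ge0_integralZl//; last 2 first.
- by move=> t _; rewrite lee_fin sqr_ge0.
- by rewrite lee_fin invr_ge0; lra.
rewrite integral_cst// [X in (_ * X)%E](@probability_setT _ _ _ P) mule1.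
apply: (@le_trans _ _ ((e / 2)%:E + (2 * e)^-1%:E * (e ^+ 2)%:E)%E).
  by rewrite leeD2l// lee_wpmul2l// lee_fin invr_ge0; lra.
rewrite -EFinM -EFinD lee_fin le_eqVlt; apply/orP; left; apply/eqP.
by field; rewrite gt_eqF.
Qed.

(** By [L1_le_sqr] the k-th increment has L^1 norm at most 2^-(k+1), and [epsilon_trick0] sums these
    bounds to at most 1. The sum of the absolute increments is thus integrable, hence finite a.e.,
    and the telescoping series converges absolutely there. *)
Lemma fast_cauchy_cvg_ae (u : nat -> T -> R) :
  (forall k, measurable_fun [set: T] (u k)) ->
  (forall k, (\int[P]_t ((u k.+1 t - u k t) ^+ 2)%:E <=
     (((1 : R) / (2 ^ k.+1)%:R) ^+ 2)%:E)%E) ->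
  {ae P, forall t, cvgn (fun k => u k t)}.
Proof.
move=> mu uk.
pose v k t : \bar R := `|u k.+1 t - u k t|%:E.
have mv k : measurable_fun [set: T] (v k).
  by apply/measurable_EFinP; apply: measurableT_comp => //; exact: measurable_funB.
have v0 k t : (0 <= v k t)%E by rewrite lee_fin.
have iv : P.-integrable [set: T] (fun t => (\sum_(k <oo) v k t)%E).
  apply/integrableP; split.
    by apply: (ge0_emeasurable_sum (P := xpredT)).
  under eq_integral do rewrite gee0_abs ?nneseries_ge0//.
  rewrite integral_nneseries//; apply: (@le_lt_trans _ _ 1%:E); last exact: ltry.
  apply: le_trans (epsilon_trick0 (R := R) xpredT ler01).
  apply: lee_nneseries => [k _ _|k _]; first exact: integral_ge0.
  by apply: L1_le_sqr => //; exact: measurable_funB.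
have := integrable_ae measurableT iv; apply: filterS => t /(_ I) fint.
have nc : cvgn [normed series (fun k => u k.+1 t - u k t)].
  apply: nondecreasing_is_cvgn.
    apply/nondecreasing_seqP => n /=.
    by rewrite /series /= big_nat_recr//= lerDl.
  exists (fine (\sum_(k <oo) v k t)%E) => _ [n _ <-].
  rewrite -lee_fin fineK// /series /= -sumEFin.
  by apply: nneseries_lim_ge.
have /normed_cvg sc := nc.
have -> : (fun k => u k t) = (fun k => u 0%N t + series (fun k => u k.+1 t - u k t) k).
  by apply/funext => k; rewrite /series /= telescope_sumr// addrC subrK.
by apply: is_cvgD => //; exact: is_cvg_cst.
Qed.

Lemma real_L2_complete (u : nat -> T -> R) :
  (forall k, measurable_fun [set: T] (u k)) ->
  (forall k j, (k <= j)%N -> (\int[P]_t ((u j t - u k t) ^+ 2)%:E <=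
     (((1 : R) / (2 ^ k.+1)%:R) ^+ 2)%:E)%E) ->
  exists2 g : T -> R, measurable_fun [set: T] g &
    forall k, (\int[P]_t ((g t - u k t) ^+ 2)%:E <=
     (((1 : R) / (2 ^ k.+1)%:R) ^+ 2)%:E)%E.
Proof.
move=> mu uk.
have cv := fast_cauchy_cvg_ae mu (fun k => uk k k.+1 (leqnSn k)).
pose g t := fine (limn_esup (fun k => (u k t)%:E)).
have mg : measurable_fun [set: T] g.
  apply: measurableT_comp => //; apply: measurable_fun_limn_esup => k.
  exact/measurable_EFinP.
exists g => // k.
have gt : {ae P, forall t, u j t @[j --> \oo] --> g t}.
  apply: filterS cv => t ct.
  have ect : (u j t)%:E @[j --> \oo] --> (limn (fun j => u j t))%:E.
    by apply: cvg_EFin => //; apply: nearW.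
  by rewrite /g (cvg_limn_einf_sup ect).2.
(* For fixed k the integrand is a.e. the lower limit over j of the squared distances, which is the
   shape Fatou's lemma needs. *)
apply: (@le_trans _ _ (\int[P]_t limn_einf (fun j => ((u j t - u k t) ^+ 2)%:E))%E).
  apply: ae_ge0_le_integral => //.
  - by move=> t _; rewrite lee_fin sqr_ge0.
  - by apply/measurable_EFinP; apply: measurable_funX; exact: measurable_funB.
  - move=> t _; rewrite limn_einf_lim; apply: lime_ge; first exact: is_cvg_einfs.
    apply: nearW => n; apply: le_ereal_inf_tmp => _ [m _ <-].
    by rewrite lee_fin sqr_ge0.
  - under eq_fun do rewrite -[limn_einf _]oppeK -limn_esupN.
    apply: measurableT_comp => //; apply: measurable_fun_limn_esup => j.
    apply: measurableT_comp => //; apply/measurable_EFinP; apply: measurable_funX.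
    exact: measurable_funB.
  apply: filterS gt => t gt _.
  have c2 : ((u j t - u k t) ^+ 2)%:E @[j --> \oo] --> ((g t - u k t) ^+ 2)%:E.
    apply: cvg_EFin; first exact: nearW.
    by apply: cvgM; apply: cvgB => //; exact: cvg_cst.
  by rewrite (cvg_limn_einf_sup c2).1.
apply: le_trans (fatou P measurableT _ _) _ => [j|j t _|].
- by apply/measurable_EFinP; apply: measurable_funX; exact: measurable_funB.
- by rewrite lee_fin sqr_ge0.
rewrite limn_einf_lim; apply: lime_le; first exact: is_cvg_einfs.
(* The infimum over indices from n on is bounded by its term at [maxn n k]: the hypothesis speaks
   only of indices at least k. *)
apply: nearW => n; apply: le_trans (uk k (maxn n k) (leq_maxr _ _)).
by apply: ereal_inf_lbound; exists (maxn n k) => //=; exact: leq_maxl.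
Qed.

End Completeness.

(** * Completeness for complex-valued functions *)

Section L2Complete.
Variable R : realType.
Local Notation C := R[i].
Local Notation mu := (@circle_measure R).
Implicit Types (f g h : R -> C) (c : C) (u : nat -> R -> C).

Definition L2_cauchy u := forall e : R, 0 < e ->
  exists N, forall m n, (N <= m)%N -> (N <= n)%N ->
    L2norm (fun t => u m t - u n t) <= e.

Lemma sqr_L2norm_EFin f : L2 f ->
  (\int[mu]_t (normc (f t) ^+ 2)%:E = (L2norm f ^+ 2)%:E)%E.
Proof.
move=> fL; rewrite sqr_L2norm -[LHS]fineK//.
by apply: integrable_fin_num => //; exact: L2_integrable.
Qed.

Lemma L2_complete_fast u : (forall k, L2 (u k)) ->
  (forall k j, (k <= j)%N ->
     L2norm (fun t => u j t - u k t) <= (1 : R) / (2 ^ k.+1)%:R) ->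
  exists2 g, L2 g & forall k,
     L2norm (fun t => g t - u k t) <= 2 * ((1 : R) / (2 ^ k.+1)%:R).
Proof.
move=> uL uk; pose e (k : nat) : R := 1 / (2 ^ k.+1)%:R.
have e0 k : 0 <= e k by rewrite divr_ge0.
have parts (q : C -> R) : (forall z, `|q z| <= normc z) -> (forall z w, q (z - w) = q z - q w) ->
    (forall k, measurable_fun [set: R] (fun t => q (u k t))) ->
    exists2 g : R -> R, measurable_fun [set: R] g &
    forall k, (\int[mu]_t ((g t - q (u k t)) ^+ 2)%:E <= (e k ^+ 2)%:E)%E.
  move=> qn qB qm; apply: (real_L2_complete (P := mu)) => // k j kj.
  have ujk : L2 (fun t => u j t - u k t) by exact: L2B.
  have mjk : measurable_fun [set: R] (fun t => q (u j t) - q (u k t)).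
    exact: measurable_funB.
  apply: (@le_trans _ _ (\int[mu]_t (normc (u j t - u k t) ^+ 2)%:E)%E).
    apply: ge0_le_integral => //.
    - by move=> t _; rewrite lee_fin sqr_ge0.
    - exact/measurable_EFinP/measurable_funX.
    - by apply: measurable_sqr_normc; exact: L2_cmeas.
    move=> t _; rewrite lee_fin -qB -[leLHS]real_normK ?num_real//.
    by rewrite ler_pXn2r// ?nnegrE ?normc_nneg.
  by rewrite sqr_L2norm_EFin// lee_fin ler_pXn2r// ?nnegrE ?L2norm_ge0//; exact: uk.
have [gr mgr gre] : exists2 g : R -> R, measurable_fun [set: R] g &
    forall k, (\int[mu]_t ((g t - complex.Re (u k t)) ^+ 2)%:E <= (e k ^+ 2)%:E)%E.
  apply: parts => [z|z w|k]; first exact: ler_Re_normc.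
    by case: z w => [a b] [c d].
  by have [] := L2_cmeas (uL k).
have [gi mgi gie] : exists2 g : R -> R, measurable_fun [set: R] g &
    forall k, (\int[mu]_t ((g t - complex.Im (u k t)) ^+ 2)%:E <= (e k ^+ 2)%:E)%E.
  apply: parts => [z|z w|k]; first exact: ler_Im_normc.
    by case: z w => [a b] [c d].
  by have [] := L2_cmeas (uL k).
pose g t : C := gr t +i* gi t.
have mg : cmeas g by [].
have gu k : (\int[mu]_t (normc (g t - u k t) ^+ 2)%:E <= (e k ^+ 2 + e k ^+ 2)%:E)%E.
  under eq_integral => t _.
    rewrite sqr_normc_sum (_ : complex.Re _ = gr t - complex.Re (u k t)); last first.
      by rewrite /g; case: (u k t).
    rewrite (_ : complex.Im _ = gi t - complex.Im (u k t)); last first.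
      by rewrite /g; case: (u k t).
    rewrite EFinD; over.
  have [m1 m2] := L2_cmeas (uL k).
  rewrite ge0_integralD//=.
  - by rewrite EFinD leeD.
  - by move=> t _; rewrite lee_fin sqr_ge0.
  - by apply/measurable_EFinP; apply: measurable_funX; exact: measurable_funB.
  - by move=> t _; rewrite lee_fin sqr_ge0.
  - by apply/measurable_EFinP; apply: measurable_funX; exact: measurable_funB.
have guL k : L2 (fun t => g t - u k t).
  have [] : cmeas (fun t => g t - u k t).
    by apply: cmeasD => //; apply: L2_cmeas; apply: L2N.
  by split => //; apply: le_lt_trans (gu k) (ltry _).
exists g.
  rewrite (_ : g = (fun t => (g t - u 0%N t) + u 0%N t)); first exact: L2D.
  by apply/funext => t; rewrite subrK.
(* Real and imaginary parts each contribute [e k ^+ 2], and [2 e^2 <= (2 e)^2] explains the factor 2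
   in the conclusion. *)
move=> k; rewrite -(@ler_pXn2r _ 2) ?nnegrE ?L2norm_ge0 ?mulr_ge0 -/(e k)//.
rewrite -lee_fin -sqr_L2norm_EFin//; apply: le_trans (gu k) _.
by rewrite lee_fin -/(e k); have := sqr_ge0 (e k); move: (e k) => x; nra.
Qed.

Lemma small_pow2 (e : R) : 0 < e -> exists k, (1 : R) / (2 ^ k.+1)%:R < e.
Proof.
move=> e0; exists (Num.bound e^-1).
rewrite div1r -[ltRHS]invrK ltf_pV2 ?posrE ?invr_gt0// ?ltr0n ?expn_gt0//.
apply: lt_trans (archi_boundP _) _; first by rewrite invr_ge0 ltW.
by rewrite ltr_nat; apply: ltn_trans (ltnSn _) _; exact: ltn_expl.
Qed.

Lemma L2_complete u : (forall k, L2 (u k)) -> L2_cauchy u ->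
  exists2 g, L2 g & L2norm (fun t => u n t - g t) @[n --> \oo] --> (0 : R).
Proof.
move=> uL uc; pose e (k : nat) : R := 1 / (2 ^ k.+1)%:R.
have e0 k : 0 < e k by rewrite divr_gt0 ?ltr0n ?expn_gt0.
have /choice[N NP] : forall k, exists N, forall m n, (N <= m)%N -> (N <= n)%N ->
  L2norm (fun t => u m t - u n t) <= e k by move=> k; exact: uc.
(* Partial sums of [N] dominate [N k] and are nondecreasing, so they index a subsequence with the
   fast Cauchy rate. *)
pose s k := (\sum_(i < k.+1) N i)%N.
have sN k : (N k <= s k)%N by rewrite /s big_ord_recr /= leq_addl.
have smono k j : (k <= j)%N -> (s k <= s j)%N.
  elim: j => [|j ih]; first by rewrite leqn0 => /eqP ->.
  rewrite leq_eqVlt => /predU1P[->//|]; rewrite ltnS => /ih /leq_trans; apply.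
  by rewrite {2}/s big_ord_recr /= leq_addr.
have [g gL gu] := @L2_complete_fast (u \o s) (fun k => uL (s k))
  (fun k j kj => NP k (s j) (s k) (leq_trans (sN k) (smono _ _ kj)) (sN k)).
exists g => //; apply/cvgrPdist_le => eps eps0.
(* A third is enough: [NP] contributes [e k] once and [gu] contributes it twice. *)
have [k ke] := small_pow2 (divr_gt0 eps0 (ltr0n R 3)).
exists (N k) => // n /= kn.
rewrite sub0r normrN ger0_norm ?L2norm_ge0//.
apply: le_trans (L2norm_triangle (uL n) (uL (s k)) gL) _.
rewrite (L2norm_distC (uL (s k)) gL).
have := NP k n (s k) kn (sN k); have := gu k; rewrite /= /e; lra.
Qed.

End L2Complete.

(** * Fourier coefficients *)

Section UnitCircle.
Variable R : realType.
Local Notation C := R[i].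
Local Notation mu := (@circle_measure R).
Local Notation zvar := (@zvar R).
Implicit Types (f g h : R -> C) (c : C).

Lemma normc_zvar t : normc (zvar t) = 1.
Proof. by rewrite /= cos2Dsin2 sqrtr1. Qed.

Lemma zvar_neq0 t : zvar t != 0.
Proof.
by apply/eqP => z0; have := normc_zvar t; rewrite z0 normc0 => /eqP; rewrite eq_sym oner_eq0.
Qed.

Lemma conj_zvar t : (zvar t)^* = (zvar t)^-1.
Proof.
apply: (mulfI (zvar_neq0 t)); rewrite mulfV ?zvar_neq0// mul_conjc normc_zvar expr1n.
by [].
Qed.

Lemma conj_zvarX t (n : int) : (zvar t ^ n)^* = zvar t ^ (- n).
Proof.
rewrite -exprz_inv -conj_zvar; case: n => n.
  by rewrite -!exprnP rmorphXn.
by rewrite !NegzE -!exprnN -!exprVn rmorphXn /= fmorphV.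
Qed.

Lemma zvar_mulJ t (m n : int) : (zvar t ^ m)^* * zvar t ^ n = zvar t ^ (n - m).
Proof. by rewrite conj_zvarX -expfzDr ?zvar_neq0// addrC. Qed.

Lemma normc_zvarX t (n : int) : normc (zvar t ^ n) = 1.
Proof.
case: n => n; first by rewrite -exprnP normcX normc_zvar expr1n.
by rewrite NegzE -exprnN normcV normcX normc_zvar expr1n invr1.
Qed.

Lemma cmeas_zvarX (n : int) : cmeas (fun t => zvar t ^ n).
Proof.
have nat_case k : cmeas (fun t => zvar t ^+ k).
  elim: k => [|k ih]; first by under eq_fun do rewrite expr0; exact: cmeas_cst.
  by under eq_fun do rewrite exprS; apply: cmeasM => //; exact: cmeas_zvar.
case: n => n; first exact: nat_case.
under eq_fun do rewrite -[Negz n]opprK -conj_zvarX.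
by apply: cmeasJ; rewrite NegzE opprK; exact: nat_case.
Qed.

Lemma L2_zvarX (n : int) : L2 (fun t => zvar t ^ n).
Proof.
by apply: (L2_bounded (M := 1)); [exact: cmeas_zvarX|apply: ae_all => t; rewrite normc_zvarX].
Qed.

Lemma L2_mul_zvarX (n : int) f : L2 f -> L2 (fun t => zvar t ^ n * f t).
Proof.
apply: (L2_mul_bounded (M := 1)); first exact: cmeas_zvarX.
by apply: ae_all => t; rewrite normc_zvarX.
Qed.

Lemma fourier_coef_zvarX_mul (m n : int) f :
  fourier_coef (fun t => zvar t ^ m * f t) n = fourier_coef f (n - m).
Proof.
rewrite /fourier_coef inner_prod_mulr; congr inner_prod; apply/funext => t.
by rewrite zvar_mulJ.
Qed.

Lemma L2norm_zvarX_mul (n : int) f : L2 f ->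
  L2norm (fun t => zvar t ^ n * f t) = L2norm f.
Proof.
by apply: L2norm_mul_unimodular; [exact: cmeas_zvarX|apply: ae_all => t; exact: normc_zvarX].
Qed.

Lemma circle_integral_cst c : circle_integral (fun=> c) = c.
Proof.
rewrite /circle_integral !Rintegral_cst//.
rewrite [X in fine X](@probability_setT _ _ _ mu) /= !mulr1.
by case: c.
Qed.

Lemma Rintegral_circle_derive (f F : R -> R) :
  (forall x : R, is_derive x (1 : R) F (f x)) -> continuous f -> (forall x, 0 <= f x) ->
  \int[mu]_t f t = (F (2 * pi) - F 0) / (2 * pi).
Proof.
move=> dF cf f0; have mf : measurable_fun [set: R] f by exact: continuous_measurable_fun.
have cF : continuous F.
  move=> x; apply: differentiable_continuous; apply/derivable1_diffP.
  by have [] := dF x.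
rewrite /Rintegral /circle_measure (integral_uniform (circle_length_gt0 R)).
- rewrite (@continuous_FTC2 _ f F).
  + by rewrite subr0 -EFinB -EFinM /= mulrC.
  + exact: circle_length_gt0.
  + exact: continuous_subspaceT.
  + split.
    * by move=> x _; have [] := dF x.
    * by apply: cvg_at_right_filter; exact: cF.
    * by apply: cvg_at_left_filter; exact: cF.
  by move=> x _; rewrite derive1E; have [_ ->] := dF x.
- exact/measurable_EFinP.
by move=> x; rewrite lee_fin.
Qed.

Lemma integrable_circle_bounded (f : R -> R) (M : R) : measurable_fun [set: R] f ->
  (forall x, `|f x| <= M) -> mu.-integrable [set: R] (EFin \o f).
Proof.
move=> mf fM; apply: (le_integrable measurableT (g := EFin \o (fun=> M))).
- exact/measurable_EFinP.
- by move=> t _; rewrite lee_fin (le_trans (fM t))// ler_norm.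
exact: integrable_circle_cst.
Qed.

(** Adding 1 makes the integrand nonnegative, as [Rintegral_circle_derive] requires, and changes the
    mean by exactly 1; the equal end values of [F] then leave only that 1. *)
Lemma Rintegral_circle_trig (f F : R -> R) :
  (forall x : R, is_derive x (1 : R) F (f x)) -> continuous f -> (forall x, `|f x| <= 1) ->
  F (2 * pi) = F 0 -> \int[mu]_t f t = 0.
Proof.
move=> dF cf f1 F0; have mf : measurable_fun [set: R] f by exact: continuous_measurable_fun.
have i1 : mu.-integrable [set: R] (EFin \o (fun=> 1)) by exact: integrable_circle_cst.
have If : mu.-integrable [set: R] (EFin \o f) by exact: integrable_circle_bounded f1.
have : \int[mu]_t (1 + f t) = 1.
  rewrite (@Rintegral_circle_derive (fun x : R => 1 + f x) (fun x : R => x + F x)).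
  - by rewrite F0 add0r addrK divff// gt_eqF// circle_length_gt0.
  - move=> x; apply: (@continuousD _ _ _ (cst 1 : R -> R) f x) ; [exact: cvg_cst|exact: cf].
  by move=> x; have := f1 x; rewrite ler_norml => /andP[]; lra.
rewrite RintegralD// Rintegral_cst// [X in fine X](@probability_setT _ _ _ mu) /=.
lra.
Qed.

Lemma zvarXnE n t : zvar t ^+ n = cos (n%:R * t) +i* sin (n%:R * t).
Proof.
elim: n => [|n ih]; first by rewrite expr0 mul0r cos0 sin0.
rewrite exprS ih -natr1 mulrDl mul1r cosD sinD /zvar.
by apply: complex_eqP => /=; ring.
Qed.

Lemma circle_integral_zvarX (k : int) :
  circle_integral (fun t => zvar t ^ k) = (k == 0)%:R.
Proof.
have pos n : circle_integral (fun t => zvar t ^+ n.+1) = 0.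
  have n0 : n.+1%:R != 0 :> R by rewrite pnatr_eq0.
  (* Since z = 1 at the angle 2 pi, so is its power; comparing parts yields the values of cosine and
     sine at (n+1) 2 pi needed for the end values of the antiderivatives. *)
  have := zvarXnE n.+1 (2 * pi).
  rewrite [X in X ^+ _](_ : _ = 1); last first.
    by rewrite /zvar mulr_natl cos2pi sin2pi.
  rewrite expr1n => -[cos1 sin0'].
  rewrite /circle_integral; under eq_Rintegral do rewrite zvarXnE /=.
  under [X in _ +i* X]eq_Rintegral do rewrite zvarXnE /=.
  apply: complex_eqP => /=.
    apply: (@Rintegral_circle_trig _ (fun x => n.+1%:R^-1 * sin (n.+1%:R * x))).
    - move=> x; apply: is_derive_eq; rewrite /GRing.scale /=.
      by field.
    - by move=> x; apply: continuous_comp; [exact: mulrl_continuous|exact: continuous_cos].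
    - by move=> x; rewrite ler_norml cos_geN1 cos_le1.
    - by rewrite -sin0' !mulr0 sin0 mulr0.
  apply: (@Rintegral_circle_trig _ (fun x => - n.+1%:R^-1 * cos (n.+1%:R * x))).
  - move=> x; apply: is_derive_eq; rewrite /GRing.scale /=.
    by field.
  - by move=> x; apply: continuous_comp; [exact: mulrl_continuous|exact: continuous_sin].
  - by move=> x; rewrite ler_norml sin_geN1 sin_le1.
  - by rewrite -cos1 mulr0 cos0.
case: k => [[|n]|n].
- by under eq_fun do rewrite expr0z; rewrite circle_integral_cst.
- by rewrite pos.
under eq_fun do rewrite -[Negz n]opprK -conj_zvarX.
rewrite circle_integralJ NegzE opprK ?pos ?rmorph0//.
apply: (cintegrable_le (b := fun=> 1)).
- exact: cmeas_zvarX.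
- exact: integrable_circle_cst.
- by move=> t; rewrite normc_zvarX.
Qed.

Lemma fourier_coef_zvarX (m n : int) :
  fourier_coef (fun t => zvar t ^ m) n = (n == m)%:R.
Proof.
rewrite -subr_eq0 -[LHS]conjCK -inner_prodC; try exact: L2_zvarX.
rewrite /inner_prod; under eq_fun do rewrite mulrC zvar_mulJ.
by rewrite circle_integral_zvarX conjC_nat.
Qed.

Lemma fourier_coefD f g n : L2 f -> L2 g ->
  fourier_coef (fun t => f t + g t) n = fourier_coef f n + fourier_coef g n.
Proof. by move=> fL gL; apply: inner_prodDl => //; exact: L2_zvarX. Qed.

Lemma fourier_coefB f g n : L2 f -> L2 g ->
  fourier_coef (fun t => f t - g t) n = fourier_coef f n - fourier_coef g n.
Proof. by move=> fL gL; apply: inner_prodBl => //; exact: L2_zvarX. Qed.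

Lemma fourier_coefZ c f n : L2 f ->
  fourier_coef (fun t => c * f t) n = c * fourier_coef f n.
Proof. by move=> fL; apply: inner_prodZl => //; exact: L2_zvarX. Qed.

(** The uniform law is carried by [0, 2 pi] and charges no point. This discards the angles where
    [cos_arc] gives no strict comparison and [arc_approx] need not tend to 0 or 1. *)
Lemma ae_circle_interior (a : R) :
  {ae mu, forall t, [/\ 0 < t, t < 2 * pi & t != a]}.
Proof.
have null (x : R) : {ae mu, forall t, t != x}.
  exists [set x]; split => //.
    apply/measure0_null_setP => //; apply: dominates_uniform_prob.
    by apply/measure0_null_setP => //; exact: lebesgue_measure_set1.
  by move=> t /= /negP; rewrite negbK => /eqP.
have inside : {ae mu, forall t, 0 <= t <= 2 * pi}.
  exists (~` `[0, 2 * pi]%classic); split.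
  - by apply: measurableC; exact: measurable_itv.
  - rewrite /= /uniform_prob integral_uniform_pdf.
    by rewrite setICl integral_set0.
  by move=> t /= h; rewrite in_itv.
have h1 := ae_imp2 (fun t (h : t != 0) k => conj h k) (null 0) (null (2 * pi)).
have h2 := ae_imp2 (fun t (h : t != a) k => conj h k) (null a) inside.
apply: ae_imp2 h1 h2 => t [t0 t1] [ta /andP[t2 t3]].
by rewrite !lt_neqAle t1 t2 t3 eq_sym t0 ta.
Qed.

End UnitCircle.

(** * Vanishing Fourier coefficients and indicators of arcs *)

Section FourierUniqueness.
Variable R : realType.
Local Notation C := R[i].
Local Notation mu := (@circle_measure R).
Local Notation zvar := (@zvar R).
Implicit Types (f g h : R -> C) (c : C).

Definition fourier_null f := L2 f /\ forall n, fourier_coef f n = 0.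

(** Multipliers spare the expansion of [arc_approx] into powers of z: they are closed under sums and
    products, and each z^n is one because it merely shifts the coefficients. *)
Definition null_multiplier (w : R -> C) :=
  forall f, fourier_null f -> fourier_null (fun t => w t * f t).

Lemma null_multiplier_cst c : null_multiplier (fun=> c).
Proof.
move=> f [fL f0]; split; first exact: L2Z.
by move=> n; rewrite fourier_coefZ// f0 mulr0.
Qed.

Lemma null_multiplierD v w : null_multiplier v -> null_multiplier w ->
  null_multiplier (fun t => v t + w t).
Proof.
move=> vm wm f fN; have [vL v0] := vm f fN; have [wL w0] := wm f fN.
under eq_fun do rewrite mulrDl.
by split; [exact: L2D|move=> n; rewrite fourier_coefD// v0 w0 addr0].
Qed.

Lemma null_multiplierM v w : null_multiplier v -> null_multiplier w ->
  null_multiplier (fun t => v t * w t).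
Proof.
move=> vm wm f fN; have := vm _ (wm _ fN).
by under eq_fun do rewrite mulrA.
Qed.

Lemma null_multiplierX w n : null_multiplier w -> null_multiplier (fun t => w t ^+ n).
Proof.
move=> wm; elim: n => [|n ih].
  by under eq_fun do rewrite expr0; exact: null_multiplier_cst.
by under eq_fun do rewrite exprS; exact: null_multiplierM.
Qed.

Lemma null_multiplier_zvarX (n : int) : null_multiplier (fun t => zvar t ^ n).
Proof.
move=> f [fL f0]; split; first exact: L2_mul_zvarX.
by move=> k; rewrite fourier_coef_zvarX_mul.
Qed.

Lemma null_multiplier_cosB s : null_multiplier (fun t => (cos (t - s))%:C).
Proof.
(* cos (t - s) is the real part of conj(z(s)) z(t). *)
rewrite (_ : (fun t => _) = (fun t => (2^-1 : R)%:C *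
    ((zvar s)^* * zvar t ^ 1 + zvar s * zvar t ^ (-1)))).
  apply: null_multiplierM; first exact: null_multiplier_cst.
  apply: null_multiplierD; apply: null_multiplierM;
    by [exact: null_multiplier_cst|exact: null_multiplier_zvarX].
apply/funext => t; rewrite expr1z -[zvar t ^ (-1)]conj_zvarX expr1z /zvar !conj_pair cosB.
by apply: complex_eqP => /=; field.
Qed.

(* Powers of [1 - y ^ n] with exponent [2 ^ n] jump at [y = 1/2]; here [y] is
   an affine function of [cos (t - s)] equal to [1/2] where the cosine is [c]. *)
Definition arc_approx (s c : R) (n : nat) (t : R) : R :=
  1 - (1 - (2^-1 + (cos (t - s) - c) / 4) ^+ n) ^+ (2 ^ n).

Lemma null_multiplier_arc_approx (s c : R) n :
  null_multiplier (fun t => (arc_approx s c n t)%:C).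
Proof.
rewrite (_ : (fun t => _) = (fun t => 1 + (-1) * (1 + (-1) *
  ((2^-1 : R)%:C + ((cos (t - s))%:C + (- c)%:C) * (4^-1 : R)%:C) ^+ n) ^+ (2 ^ n))).
  have nc := null_multiplier_cst.
  apply: null_multiplierD => //; apply: null_multiplierM => //; apply: null_multiplierX.
  apply: null_multiplierD => //; apply: null_multiplierM => //; apply: null_multiplierX.
  apply: null_multiplierD => //; apply: null_multiplierM => //.
  by apply: null_multiplierD => //; exact: null_multiplier_cosB.
apply/funext => t; rewrite /arc_approx !mulN1r.
by rewrite !(rmorphB, rmorphXn, rmorphD, rmorphM, rmorph1, rmorphN).
Qed.

Lemma bernoulli_ineq (x : R) n : 0 <= x <= 1 -> 1 - n%:R * x <= (1 - x) ^+ n.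
Proof.
move=> /andP[x0 x1]; elim: n => [|n ih]; first by rewrite mul0r subr0 expr0.
rewrite exprS -natr1 mulrDl mul1r.
apply: (@le_trans _ _ ((1 - x) * (1 - n%:R * x))); last by rewrite ler_wpM2l// subr_ge0.
have := mulr_ge0 (ler0n R n) (sqr_ge0 x); rewrite expr2; lra.
Qed.

Lemma bernoulli_ineq_pos (x : R) n : 0 <= x -> 1 + n%:R * x <= (1 + x) ^+ n.
Proof.
move=> x0; elim: n => [|n ih]; first by rewrite mul0r addr0 expr0.
rewrite exprS -natr1 mulrDl mul1r.
apply: (@le_trans _ _ ((1 + x) * (1 + n%:R * x))); last by rewrite ler_wpM2l// addr_ge0.
have := mulr_ge0 (ler0n R n) (sqr_ge0 x); rewrite expr2; lra.
Qed.

(** Bernoulli's inequality bounds the expression by [2^n y^n = (2 y)^n], which tends to 0 because 2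
    y < 1. *)
Lemma jump_below (y : R) : 0 <= y < 2^-1 ->
  1 - (1 - y ^+ n) ^+ (2 ^ n) @[n --> \oo] --> (0 : R).
Proof.
move=> /andP[y0 y1].
have c0 : (2 * y) ^+ n @[n --> \oo] --> (0 : R).
  by apply: cvg_expr; rewrite ger0_norm ?mulr_ge0//; lra.
apply: (squeeze_cvgr _ (@cvg_cst _ 0 _ _ _) c0); apply: nearW => n.
have yn : 0 <= y ^+ n <= 1 by rewrite exprn_ge0//= exprn_ile1//; lra.
rewrite subr_ge0 exprn_ile1 ?subr_ge0 ?gerBl//=; last 2 first.
- by case/andP: yn.
- by case/andP: yn.
rewrite lerBlDr -lerBlDl exprMn -natrX; exact: bernoulli_ineq.
Qed.

(** The product of [(1 - y^n)^(2^n)] and [(1 + y^n)^(2^n)] is at most 1, and by Bernoulli the second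
    factor is at least [(2 y)^n]; so the first is at most [(2 y)^-n], which tends to 0. *)
Lemma jump_above (y : R) : 2^-1 < y <= 1 ->
  1 - (1 - y ^+ n) ^+ (2 ^ n) @[n --> \oo] --> (1 : R).
Proof.
move=> /andP[y0 y1].
have c0 : 1 - ((2 * y)^-1) ^+ n @[n --> \oo] --> (1 - 0 : R).
  apply: cvgB; first exact: cvg_cst.
  apply: cvg_expr; rewrite ger0_norm ?invr_ge0 ?mulr_ge0//; last lra.
  by rewrite invf_lt1 ?mulr_gt0//; lra.
rewrite subr0 in c0.
apply: (squeeze_cvgr _ c0 (cvg_cst (1 : R))); apply: nearW => n.
have yn : 0 <= y ^+ n <= 1 by rewrite exprn_ge0 ?exprn_ile1//; lra.
have /andP[yn0 yn1] := yn.
rewrite gerBl exprn_ge0 ?subr_ge0// andbT lerD2l lerN2 exprVn.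
have p0 : 0 < (2 * y) ^+ n by rewrite exprn_gt0//; lra.
rewrite -[leRHS]mul1r ler_pdivlMr//.
apply: (@le_trans _ _ ((1 - y ^+ n) ^+ (2 ^ n) * (1 + y ^+ n) ^+ (2 ^ n))).
  rewrite ler_wpM2l ?exprn_ge0 ?subr_ge0//.
  apply: le_trans (bernoulli_ineq_pos _ yn0).
  by rewrite exprMn -natrX lerDr.
rewrite -exprMn exprn_ile1 ?mulr_ge0 ?subr_ge0 ?addr_ge0//.
have := sqr_ge0 (y ^+ n); rewrite expr2; lra.
Qed.

Lemma arc_approx_le1 (s c : R) n t : `|c| <= 1 -> 0 <= arc_approx s c n t <= 1.
Proof.
rewrite ler_norml /arc_approx => /andP[c0 c1].
have := cos_le1 (t - s); have := cos_geN1 (t - s).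
(* The cosine and [c] differ by at most 2, so the divisor 4 keeps [y] within 1/2 of 1/2. *)
set y := 2^-1 + _ => u v; have y01 : 0 <= y <= 1 by rewrite /y; lra.
have /andP[y0 y1] := y01.
have yn : 0 <= 1 - y ^+ n <= 1.
  by rewrite subr_ge0 gerBl exprn_ge0// exprn_ile1.
have /andP[yn0 yn1] := yn.
by rewrite subr_ge0 gerBl exprn_ile1//= exprn_ge0.
Qed.

Lemma arc_approx_cvg_out (s c t : R) : `|c| <= 1 -> cos (t - s) < c ->
  arc_approx s c n t @[n --> \oo] --> (0 : R).
Proof.
rewrite ler_norml => /andP[c0 c1] h; apply: jump_below.
by have := cos_geN1 (t - s); lra.
Qed.

Lemma arc_approx_cvg_in (s c t : R) : `|c| <= 1 -> c < cos (t - s) ->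
  arc_approx s c n t @[n --> \oo] --> (1 : R).
Proof.
rewrite ler_norml => /andP[c0 c1] h; apply: jump_above.
by have := cos_le1 (t - s); lra.
Qed.

Lemma measurable_arc_approx (s c : R) n : measurable_fun [set: R] (arc_approx s c n).
Proof.
apply: measurable_funB => //; apply: measurable_funX.
apply: measurable_funB => //; apply: measurable_funX.
apply: measurable_funD => //; apply: measurable_funM => //.
apply: measurable_funB => //; apply: continuous_measurable_fun => x.
by apply: continuous_comp; [apply: cvgB; [exact: cvg_id|exact: cvg_cst]|exact: continuous_cos].
Qed.

(** [s] is the midpoint of the arc (a, 2 pi) and [h] its half-length: a point lies inside the arc
    when its angular distance to [s] is below [h], and the cosine decreases with that distance on
    [0, pi]. *)
Lemma cos_arc (a t : R) : 0 < a < 2 * pi -> 0 < t < 2 * pi -> t != a ->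
  let s := pi + a / 2 in let h := pi - a / 2 in
  if a < t then cos h < cos (t - s) else cos (t - s) < cos h.
Proof.
move=> /andP[a0 a2] /andP[t0 t2] ta /=; have p0 := pi_gt0 R.
have cosI (x y : R) : 0 <= x <= pi -> 0 <= y <= pi -> (cos x < cos y) = (y < x).
  by move=> x0 y0; rewrite ltr_cos ?in_itv.
case: ifPn => [at_|]; last rewrite -leNgt le_eqVlt (negbTE ta) /= => tia.
  have [u0|u0] := leP 0 (t - (pi + a / 2)).
    by rewrite cosI; lra.
  by rewrite -[cos (t - _)]cosN cosI; lra.
(* Left of the arc, t - s can drop below -pi; the distance to [s] is then measured the other way
   round, after adding 2 pi. *)
have [u0|u0] := leP (- pi) (t - (pi + a / 2)).
  by rewrite -[cos (t - _)]cosN cosI; lra.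
by rewrite -(cosD2pi (t - _)) -mulr_natl cosI; lra.
Qed.

Variable phi : R -> R.
Hypothesis iphi : mu.-integrable [set: R] (EFin \o phi).
Hypothesis phi0 : (\int[mu]_t (phi t)%:E = 0)%E.
Hypothesis phi_arc : forall (s c : R) n, (\int[mu]_t (phi t * arc_approx s c n t)%:E = 0)%E.

(** Rays generate the Borel sets, and up to a null set the ray from a in (0, 2 pi) is the arc (a, 2
    pi). There [phi] times [arc_approx] converges a.e. to [phi] restricted to the ray, dominated by
    [|phi|]; rays starting elsewhere meet all or nothing of the circle. *)
Lemma integral_ray0 a : (\int[mu]_(t in `]a, +oo[) (phi t)%:E = 0)%E.
Proof.
have mphi := measurable_int _ iphi.
have mray : measurable_fun [set: R] ((fun t => (phi t)%:E) \_ `]a, +oo[)%E.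
  by apply/(measurable_restrictT _ _).1 => //; exact: measurable_funTS.
rewrite integral_mkcond.
have [a0|a0] := leP a 0.
  rewrite -[RHS]phi0; apply: ae_eq_integral => //.
  apply: ae_imp (ae_circle_interior 0) => t [t0 _ _] _.
  by rewrite patchE mem_set//= in_itv/= andbT (le_lt_trans a0).
have [a2|a2] := leP (2 * pi) a.
  rewrite -[RHS](integral0 mu [set: R]); apply: ae_eq_integral => //.
  apply: ae_imp (ae_circle_interior 0) => t [_ t2 _] _.
  rewrite patchE memNset//= in_itv/= andbT => a_t.
  by have := lt_trans t2 (le_lt_trans a2 a_t); rewrite ltxx.
pose s := pi + a / 2; pose c : R := cos (pi - a / 2).
have c1 : `|c| <= 1 by rewrite ler_norml cos_geN1 cos_le1.
have := @dominated_convergence _ _ _ mu _ measurableT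
  (fun n t => (phi t * arc_approx s c n t)%:E) ((fun t => (phi t)%:E) \_ `]a, +oo[)%E
  (fun t => `|phi t|%:E).
case=> //.
- move=> n; apply/measurable_EFinP; apply: measurable_funM; last exact: measurable_arc_approx.
  exact/measurable_EFinP.
- apply: ae_imp (ae_circle_interior a) => t [t0 t2 ta] _.
  have := @cos_arc a t; rewrite a0 a2 t0 t2 => /(_ isT isT ta) /=.
  rewrite patchE; case: ifPn => at_ h.
    rewrite mem_set/=; last by rewrite in_itv/= at_.
    apply: cvg_EFin; first exact: nearW.
    rewrite -[X in _ --> X]mulr1; apply: cvgM; first exact: cvg_cst.
    exact: arc_approx_cvg_in.
  rewrite memNset/=; last by rewrite in_itv/= (negbTE at_).
  apply: cvg_EFin; first exact: nearW.
  rewrite -[X in _ --> X](mulr0 (phi t)); apply: cvgM; first exact: cvg_cst.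
  exact: arc_approx_cvg_out.
- exact: (integrable_abse iphi).
- apply: ae_all => t n _; rewrite lee_fin normrM -[leRHS]mulr1 ler_wpM2l//.
  by have /andP[A0 A1] := arc_approx_le1 s n t c1; rewrite ger0_norm.
move=> _ _; under eq_fun do rewrite phi_arc.
by move/cvg_lim => <- //; rewrite lim_cst.
Qed.

(** Dynkin's argument: rays are stable under intersection, and the sets over which [phi] integrates
    to 0 are stable under complement, thanks to [phi0], and under disjoint countable unions. *)
Lemma integral_borel0 (E : set (measurableTypeR R)) : measurable E ->
  (\int[mu]_(t in E) (phi t)%:E = 0)%E.
Proof.
move=> mE; apply: (@dynkin_induction _ (measurableTypeR R) (RGenOInfty.G (R := R))
  (fun E => \int[mu]_(t in E) (phi t)%:E = 0)%E) => //.
- by rewrite RGenOInfty.measurableE.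
- move=> _ _ [x ->] [y ->]; exists (Num.max x y).
  apply/seteqP; split => t /=; rewrite !in_itv/= !andbT gt_max.
    by move=> [-> ->].
  by move=> /andP[-> ->].
- by move=> _ [x ->]; exact: integral_ray0.
- move=> S mS S0.
  have := @integral_setU_EFin _ _ _ mu S (~` S) phi mS (measurableC mS).
  rewrite setUCr S0 phi0 add0e => <- //.
    by have /measurable_EFinP := measurable_int _ iphi.
  by apply/disj_setPS; rewrite setICr.
- move=> F mF tF F0; rewrite integral_bigcup//.
    by rewrite eseries0.
  by apply: integrableS iphi => //; exact: bigcup_measurable.
suff : (RGenOInfty.G (R := R)).-sigma.-measurable E by [].
by rewrite -RGenOInfty.measurableE.
Qed.

Lemma arc_null_ae : phi = (fun=> 0) %[ae mu].
Proof.
have /(_ _) h := integral_ae_eq measurableT iphi (@measurable_cst _ _ _ _ setT 0%E).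
have : ae_eq mu setT (EFin \o phi) (cst 0%E).
  by apply: h => E _ mE; rewrite integral_borel0// integral0.
by apply: ae_imp => t /(_ I) [].
Qed.

End FourierUniqueness.

(** * Uniqueness of Fourier coefficients for complex functions *)

Section FourierUniquenessComplex.
Variable R : realType.
Local Notation mu := (@circle_measure R).

Lemma fourier_null_ae (f : R -> R[i]) : fourier_null f -> f = (fun=> 0) %[ae mu].
Proof.
move=> fN; have [fL f0] := fN.
have if1 (g : R -> R[i]) : L2 g -> cintegrable g.
  move=> gL; have := L2_mulJ_integrable gL (L2_cst 1).
  by under eq_fun do rewrite conjC1 mulr1.
have int0 (g : R -> R[i]) : fourier_null g -> circle_integral g = 0.
  move=> [gL /(_ 0)]; rewrite /fourier_coef /inner_prod.
  by under eq_fun do rewrite expr0z conjC1 mulr1.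
(* [q] is the real or the imaginary part. The arc approximants are real, so [q] commutes with
   multiplication by them and the real-valued result applies to [q \o f]. *)
have part (q : R[i] -> R) : (forall g, circle_integral g = 0 -> cintegrable g ->
      (\int[mu]_t (q (g t))%:E = 0)%E) ->
    (forall (x : R) z, q (x%:C * z) = q z * x) ->
    mu.-integrable [set: R] (EFin \o (q \o f)) ->
    {ae mu, forall t, q (f t) = 0}.
  move=> qi qZ iq; have : q \o f = (fun=> 0) %[ae mu].
    apply: arc_null_ae => //; first by apply: qi; [exact: int0|exact: if1].
    move=> s c n /=; under eq_integral do rewrite /= -qZ.
    have hN := null_multiplier_arc_approx s c n fN.
    by apply: qi; [exact: int0|apply: if1; case: hN].
  by apply: ae_imp => t /(_ I).
have [i1 i2] := if1 f fL.
have r0 : {ae mu, forall t, complex.Re (f t) = 0}.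
  apply: part => //; last by move=> x [a b] /=; ring.
  move=> g g0 [g1 _]; rewrite -[LHS]fineK; last exact: integrable_fin_num.
  by congr EFin; rewrite -[0]/(complex.Re 0) -g0.
have s0 : {ae mu, forall t, complex.Im (f t) = 0}.
  apply: part => //; last by move=> x [a b] /=; ring.
  move=> g g0 [_ g1]; rewrite -[LHS]fineK; last exact: integrable_fin_num.
  by congr EFin; rewrite -[0]/(complex.Im 0) -g0.
by apply: ae_imp2 r0 s0 => t r s _; exact: complex_eqP.
Qed.

End FourierUniquenessComplex.

(** * The Riesz projection and the Hardy space *)

Section HardySpaceTheory.
Variable R : realType.
Local Notation C := R[i].
Local Notation mu := (@circle_measure R).
Local Notation zvar := (@zvar R).
Implicit Types (f g h : R -> C) (c : nat -> C).

Definition L2lim (u : nat -> R -> C) g :=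
  L2norm (fun t => u n t - g t) @[n --> \oo] --> (0 : R).

Lemma eq0_normc_le (x : C) (e : nat -> R) : e n @[n --> \oo] --> (0 : R) ->
  (\forall n \near \oo, normc x <= e n) -> x = 0.
Proof.
move=> e0 xe; apply: eq0_normc; apply/eqP; rewrite eq_le normc_nneg andbT.
by have := limr_ge (cvgP _ e0) xe; rewrite (cvg_lim (@Rhausdorff R) e0) => xle0; exact: xle0.
Qed.

Lemma inner_prod_lim_eq u g h (x : C) : (forall n, L2 (u n)) -> L2 g -> L2 h ->
  L2lim u g -> (\forall n \near \oo, inner_prod (u n) h = x) -> inner_prod g h = x.
Proof.
move=> uL gL hL ug ux; apply/eqP; rewrite -subr_eq0; apply/eqP.
apply: (@eq0_normc_le _ (fun n => L2norm (fun t => u n t - g t) * L2norm h)).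
  by rewrite -[X in _ --> X](mul0r (L2norm h)); apply: cvgM => //; exact: cvg_cst.
near=> n; rewrite -(near ux n)//.
rewrite -normcN opprB -inner_prodBl//; apply: cauchy_schwarz => //; exact: L2B.
Unshelve. all: by end_near. Qed.

Definition zpoly c N : R -> C := fun t => \sum_(i < N) c i * zvar t ^ i%:Z.

Lemma L2_zpoly c N : L2 (zpoly c N).
Proof. by apply: L2_sum => i; apply: L2Z; exact: L2_zvarX. Qed.

Lemma fourier_coef_zpoly c N n :
  fourier_coef (zpoly c N) n = \sum_(i < N) c i * (n == i%:Z)%:R.
Proof.
rewrite /fourier_coef /zpoly inner_prod_suml; last exact: L2_zvarX.
  apply: eq_bigr => i _; rewrite inner_prodZl; try exact: L2_zvarX.
  by congr (_ * _); exact: fourier_coef_zvarX.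
by move=> i; apply: L2Z; exact: L2_zvarX.
Qed.

Lemma fourier_coef_zpoly_nat c N (k : nat) :
  fourier_coef (zpoly c N) k%:Z = if (k < N)%N then c k else 0.
Proof.
rewrite fourier_coef_zpoly; case: ifPn => [kN|kN].
  rewrite (bigD1 (Ordinal kN))//= eqxx mulr1 big1 ?addr0// => i /negP ik.
  case: eqP => [[ki]|]; last by rewrite mulr0.
  by exfalso; apply: ik; apply/eqP/val_inj.
rewrite big1// => i _; case: eqP => [[ki]|]; last by rewrite mulr0.
by move: kN; rewrite ki ltn_ord.
Qed.

Lemma fourier_coef_zpoly_neg c N n : n < 0 -> fourier_coef (zpoly c N) n = 0.
Proof.
move=> n0; rewrite fourier_coef_zpoly big1// => i _.
by case: eqP => [ni|]; rewrite ?mulr0//; move: n0; rewrite ni.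
Qed.

Lemma H2_zpoly c N : H2 (zpoly c N).
Proof. by split; [exact: L2_zpoly|move=> n; exact: fourier_coef_zpoly_neg]. Qed.

Lemma inner_prod_zpolyr c N f : L2 f ->
  inner_prod f (zpoly c N) = \sum_(i < N) (c i)^* * fourier_coef f i%:Z.
Proof.
move=> fL; rewrite /zpoly inner_prod_sumr//.
  by apply: eq_bigr => i _; rewrite inner_prodZr//; exact: L2_zvarX.
by move=> i; apply: L2Z; exact: L2_zvarX.
Qed.

Lemma inner_prod_zpolyl c N f : L2 f ->
  inner_prod (zpoly c N) f = \sum_(i < N) c i * (fourier_coef f i%:Z)^*.
Proof.
move=> fL; rewrite (inner_prodC fL (L2_zpoly c N)) inner_prod_zpolyr// conjC_sum.
by apply: eq_bigr => i _; rewrite conjCM conjCK.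
Qed.

Lemma sqr_L2norm_zpoly c N : L2norm (zpoly c N) ^+ 2 = \sum_(i < N) normc (c i) ^+ 2.
Proof.
apply: (@complexI R); rewrite -inner_prod_self inner_prod_zpolyr; last exact: L2_zpoly.
rewrite rmorph_sum; apply: eq_bigr => i _.
by rewrite fourier_coef_zpoly_nat ltn_ord mulrC mul_conjc.
Qed.

Definition taylor f := zpoly (fun i => fourier_coef f i%:Z).

Lemma L2norm_pythagoras f g : L2 f -> L2 g -> inner_prod (fun t => f t - g t) g = 0 ->
  L2norm f ^+ 2 = L2norm (fun t => f t - g t) ^+ 2 + L2norm g ^+ 2.
Proof.
move=> fL gL fg; rewrite (_ : L2norm f = L2norm (fun t => (f t - g t) + g t)).
  by rewrite sqr_L2normD ?fg ?mulr0 ?addr0//; exact: L2B.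
by congr L2norm; apply/funext => t; rewrite subrK.
Qed.

Lemma taylor_pythagoras f N : L2 f ->
  L2norm f ^+ 2 = L2norm (fun t => f t - taylor f N t) ^+ 2 + L2norm (taylor f N) ^+ 2.
Proof.
move=> fL; apply: L2norm_pythagoras => //; first exact: L2_zpoly.
rewrite inner_prod_zpolyr; last by apply: L2B => //; exact: L2_zpoly.
rewrite big1// => i _; rewrite fourier_coefB//; last exact: L2_zpoly.
by rewrite fourier_coef_zpoly_nat ltn_ord subrr mulr0.
Qed.

Lemma zpoly_pythagoras c m n : (n <= m)%N -> L2norm (zpoly c m) ^+ 2 =
  L2norm (fun t => zpoly c m t - zpoly c n t) ^+ 2 + L2norm (zpoly c n) ^+ 2.
Proof.
move=> nm; apply: L2norm_pythagoras; try exact: L2_zpoly.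
rewrite inner_prod_zpolyr; last by apply: L2B; exact: L2_zpoly.
rewrite big1// => i _; rewrite fourier_coefB; try exact: L2_zpoly.
rewrite !fourier_coef_zpoly_nat ltn_ord.
by rewrite (leq_trans (ltn_ord i) nm) subrr mulr0.
Qed.

(** The squared norms [S N] increase and stay below [||f||^2] (Bessel), so they converge; by
    Pythagoras the squared distance of two Taylor polynomials is a difference of values of [S]. *)
Lemma taylor_cauchy f : L2 f -> L2_cauchy (taylor f).
Proof.
move=> fL; pose S N := L2norm (taylor f N) ^+ 2.
have ndS m n : (m <= n)%N -> S m <= S n.
  by move=> mn; rewrite /S (zpoly_pythagoras _ mn) lerDr sqr_ge0.
have cS : cvgn S.
  apply: nondecreasing_is_cvgn => //; exists (L2norm f ^+ 2) => _ [n _ <-].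
  by rewrite (taylor_pythagoras n fL) lerDr sqr_ge0.
move=> e e0.
have /cvgrPdist_le /(_ (e ^+ 2)) := cS.
rewrite exprn_gt0// => /(_ isT) [N _ NP].
have ub n : S n <= limn S by apply: nondecreasing_cvgn_le.
have half m n : (N <= n)%N -> (n <= m)%N ->
    L2norm (fun t => taylor f m t - taylor f n t) <= e.
  move=> Nn nm; rewrite -(@ler_pXn2r _ 2) ?nnegrE ?L2norm_ge0 ?(ltW e0)//.
  have := zpoly_pythagoras (fun i => fourier_coef f i%:Z) nm.
  rewrite -/(taylor f m) -/(taylor f n) -/(S m) -/(S n) => h.
  have h2 : limn S - S n <= e ^+ 2 := le_trans (ler_norm _) (NP n Nn).
  have := ub m; move: (limn S) (S m) (S n) h h2 => l x y; lra.
exists N => m n Nm Nn.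
have [nm|/ltnW mn] := leqP n m; first exact: half.
by rewrite L2norm_distC; try exact: L2_zpoly; exact: half.
Qed.

(** Each Fourier coefficient of [taylor f N] is constant from some N on, and coefficients pass to
    L^2 limits. *)
Lemma riesz_projection f : L2 f -> exists g,
  [/\ H2 g, forall k : nat, fourier_coef g k%:Z = fourier_coef f k%:Z &
      L2lim (taylor f) g].
Proof.
move=> fL; have tL N : L2 (taylor f N) by exact: L2_zpoly.
have [g gL tg] := L2_complete tL (taylor_cauchy fL).
exists g; split => //.
  split => // n n0; apply: (inner_prod_lim_eq tL gL (L2_zvarX R n) tg).
  by apply: nearW => N; exact: fourier_coef_zpoly_neg.
move=> k; apply: (inner_prod_lim_eq tL gL (L2_zvarX R k%:Z) tg).
exists k.+1 => // N /= kN.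
by have := fourier_coef_zpoly_nat (fun i => fourier_coef f i%:Z) N k; rewrite kN.
Qed.

Lemma H2_L2 f : H2 f -> L2 f. Proof. by case. Qed.

Lemma taylor_cvg f : H2 f -> L2lim (taylor f) f.
Proof.
move=> [fL fneg]; have [g [[gL gneg] gf tg]] := riesz_projection fL.
have fg : f = g %[ae mu].
  have : (fun t => f t - g t) = (fun=> 0) %[ae mu].
    apply: fourier_null_ae; split; first exact: L2B.
    move=> n; rewrite fourier_coefB//; case: n => n; first by rewrite gf subrr.
    by rewrite fneg// gneg// subrr.
  by apply: ae_imp => t h /h /eqP; rewrite subr_eq0 => /eqP.
rewrite /L2lim (_ : (fun n => _) = (fun n => L2norm (fun t => taylor f n t - g t)))//.
apply/funext => n; apply: L2norm_ae; try by apply: L2B => //; exact: L2_zpoly.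
by apply: ae_imp fg => t h /h ->.
Qed.

(** [h] is a limit of polynomials in z, which pair only with the nonnegative coefficients of [f]. *)
Lemma inner_prod_H2_eq0 h f : H2 h -> L2 f ->
  (forall k : nat, fourier_coef f k%:Z = 0) -> inner_prod h f = 0.
Proof.
move=> hH fL f0; apply: (inner_prod_lim_eq _ (H2_L2 hH) fL (taylor_cvg hH)).
  by move=> n; exact: L2_zpoly.
apply: nearW => n; rewrite inner_prod_zpolyl// big1// => i _.
by rewrite f0 conjC0 mulr0.
Qed.

Lemma H2_cst (a : C) : H2 (fun=> a).
Proof.
have -> : (fun=> a) = zpoly (fun=> a) 1.
  by apply/funext => t; rewrite /zpoly big_ord1 expr0z mulr1.
exact: H2_zpoly.
Qed.

Lemma fourier_coef_cst (a : C) n : fourier_coef (fun=> a) n = a * (n == 0)%:R.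
Proof.
have -> : (fun=> a) = (fun t => a * zvar t ^ 0).
  by apply/funext => t; rewrite expr0z mulr1.
rewrite fourier_coefZ; last exact: L2_zvarX.
by rewrite fourier_coef_zvarX.
Qed.

Lemma H2D f g : H2 f -> H2 g -> H2 (fun t => f t + g t).
Proof.
move=> [fL f0] [gL g0]; split; first exact: L2D.
by move=> n n0; rewrite fourier_coefD// f0// g0// addr0.
Qed.

Lemma H2Z (a : C) f : H2 f -> H2 (fun t => a * f t).
Proof.
move=> [fL f0]; split; first exact: L2Z.
by move=> n n0; rewrite fourier_coefZ// f0// mulr0.
Qed.

Lemma H2B f g : H2 f -> H2 g -> H2 (fun t => f t - g t).
Proof.
move=> fH /(H2Z (-1)) gH; have := H2D fH gH.
by under eq_fun do rewrite mulN1r.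
Qed.

Lemma H2_mul_zvar f : H2 f -> H2 (fun t => zvar t ^ 1 * f t).
Proof.
move=> [fL f0]; split; first exact: L2_mul_zvarX.
by move=> n n0; rewrite fourier_coef_zvarX_mul f0//; lia.
Qed.

End HardySpaceTheory.

(** * Model spaces *)

Section ModelSpaces.
Variable R : realType.
Local Notation C := R[i].
Local Notation mu := (@circle_measure R).
Local Notation zvar := (@zvar R).
Implicit Types (f g h x y : R -> C).

Variable alpha : R -> C.
Hypothesis ia : inner_function alpha.
Local Notation K := (model_space alpha).

Lemma inner_H2 : H2 alpha. Proof. by case: ia => -[]. Qed.
Lemma inner_unimodular : {ae mu, forall t, normc (alpha t) = 1}. Proof. by case: ia. Qed.
Let aL := H2_L2 inner_H2.
Let ma := L2_cmeas aL.

Lemma inner_le1 : {ae mu, forall t, normc (alpha t) <= 1}.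
Proof. by apply: ae_imp inner_unimodular => t ->. Qed.

Lemma inner_conj_le1 : {ae mu, forall t, normc (alpha t)^* <= 1}.
Proof. by apply: ae_imp inner_le1 => t; rewrite normc_conj. Qed.

Lemma L2_inner_mul f : L2 f -> L2 (fun t => alpha t * f t).
Proof. exact: (L2_mul_bounded ma inner_le1). Qed.

Lemma L2_inner_mulJ f : L2 f -> L2 (fun t => (alpha t)^* * f t).
Proof. exact: (L2_mul_bounded (cmeasJ ma) inner_conj_le1). Qed.

Lemma inner_prod_inner_mul f g : L2 f -> L2 g ->
  inner_prod (fun t => alpha t * f t) (fun t => alpha t * g t) = inner_prod f g.
Proof.
move=> fL gL; rewrite inner_prod_mulr; apply: inner_prod_ae => //.
- by apply: L2_inner_mulJ; exact: L2_inner_mul.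
- exact: ae_all.
apply: ae_imp inner_unimodular => t a1 _.
by rewrite mulrA [_^* * _]mulrC mul_conjc a1 expr1n mul1r.
Qed.

Lemma fourier_coef_inner_mulJ_zvarX (k n : int) :
  fourier_coef (fun t => (alpha t)^* * zvar t ^ k) n = (fourier_coef alpha (k - n))^*.
Proof.
rewrite /fourier_coef inner_prod_mulr inner_prodC//.
- congr (_^*).
  under eq_fun do rewrite conjCK mulrC.
  by rewrite inner_prod_mulr; congr inner_prod; apply/funext => t; rewrite zvar_mulJ.
- under eq_fun do rewrite conjCK; apply: L2_inner_mul; exact: L2_zvarX.
- exact: L2_zvarX.
Qed.

(** For n < 0 the function conj(alpha) z^n has no coefficient of nonnegative index, so it is
    orthogonal to [h]; moving [alpha] across the inner product gives the claim. *)
Lemma H2_inner_mul h : H2 h -> H2 (fun t => alpha t * h t).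
Proof.
move=> hH; split; first by apply: L2_inner_mul; exact: H2_L2.
move=> n n0; rewrite /fourier_coef inner_prod_mulr.
apply: inner_prod_H2_eq0 => //; first by apply: L2_inner_mulJ; exact: L2_zvarX.
move=> k; rewrite fourier_coef_inner_mulJ_zvarX.
by have [_ ->] := inner_H2; rewrite ?conjC0//; lia.
Qed.

(** conj(alpha) and the constant conj(alpha(0)) have the same coefficients of nonnegative index, so
    they have the same inner product with [h]. *)
Lemma fourier_coef_inner_mul0 h : H2 h ->
  fourier_coef (fun t => alpha t * h t) 0 = fourier_coef alpha 0 * fourier_coef h 0.
Proof.
move=> hH; have hL := H2_L2 hH.
have aJL : L2 (fun t => (alpha t)^* * zvar t ^ 0) by apply: L2_inner_mulJ; exact: L2_zvarX.
have cL : L2 (fun t => (fourier_coef alpha 0)^* * zvar t ^ 0).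
  by apply: L2Z; exact: L2_zvarX.
rewrite {1}/fourier_coef inner_prod_mulr; apply/eqP; rewrite -subr_eq0.
have {1}-> : fourier_coef alpha 0 * fourier_coef h 0 =
    inner_prod h (fun t => (fourier_coef alpha 0)^* * zvar t ^ 0).
  by rewrite inner_prodZr ?conjCK//; exact: L2_zvarX.
rewrite -inner_prodBr//; apply/eqP; apply: inner_prod_H2_eq0 => //; first exact: L2B.
move=> k; rewrite fourier_coefB// fourier_coef_inner_mulJ_zvarX fourier_coefZ; last exact: L2_zvarX.
rewrite fourier_coef_zvarX; case: k => [|k]; first by rewrite subr0 mulr1 subrr.
by have [_ ->] := inner_H2; rewrite ?conjC0 ?mulr0 ?subrr//; lia.
Qed.

Lemma model_H2 f : K f -> H2 f. Proof. by case. Qed.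
Lemma model_L2 f : K f -> L2 f. Proof. by case => -[]. Qed.

Lemma model_ortho f h : K f -> H2 h -> inner_prod f (fun t => alpha t * h t) = 0.
Proof. by case=> _ fo hH; apply: fo; exists h. Qed.

Lemma model_ortho_l f h : K f -> H2 h -> inner_prod (fun t => alpha t * h t) f = 0.
Proof.
move=> fK hH; rewrite inner_prodC ?model_ortho ?conjC0//; first exact: model_L2.
by apply: L2_inner_mul; exact: H2_L2.
Qed.

Lemma modelP f : H2 f -> (forall h, H2 h -> inner_prod f (fun t => alpha t * h t) = 0) -> K f.
Proof. by move=> fH fo; split => // _ [h hH <-]; exact: fo. Qed.

Lemma modelD f g : K f -> K g -> K (fun t => f t + g t).
Proof.
move=> fK gK; apply: modelP; first by apply: H2D; exact: model_H2.
move=> h hH; rewrite inner_prodDl ?model_ortho ?addr0//; try exact: model_L2.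
by apply: L2_inner_mul; exact: H2_L2.
Qed.

Lemma modelZ (c : C) f : K f -> K (fun t => c * f t).
Proof.
move=> fK; apply: modelP; first by apply: H2Z; exact: model_H2.
move=> h hH; rewrite inner_prodZl ?model_ortho ?mulr0//; first exact: model_L2.
by apply: L2_inner_mul; exact: H2_L2.
Qed.

Lemma modelB f g : K f -> K g -> K (fun t => f t - g t).
Proof.
by move=> fK /(modelZ (-1)) /(modelD fK); under eq_fun do rewrite mulN1r.
Qed.

Lemma model_eq0 f : K f -> (forall h, K h -> inner_prod f h = 0) -> f = (fun=> 0) %[ae mu].
Proof.
move=> fK /(_ _ fK); rewrite inner_prod_self => /complexI /eqP.
rewrite expf_eq0 /= => /eqP; apply: L2norm_eq0; exact: model_L2.
Qed.

(* The projection onto the model space is [P_+ - alpha P_+ conj(alpha)]. *)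
Lemma oproj_model_ex f : L2 f -> exists g, K g /\
  forall h, K h -> inner_prod (fun t => f t - g t) h = 0.
Proof.
move=> fL; have fJL := L2_inner_mulJ fL.
have [p [pH pf _]] := riesz_projection fL.
have [q [qH qf _]] := riesz_projection fJL.
have pL := H2_L2 pH; have qL := H2_L2 qH; have aqL := L2_inner_mul qL.
have ortho u v h : L2 u -> L2 v -> (forall k : nat, fourier_coef v k%:Z = fourier_coef u k%:Z) ->
    H2 h -> inner_prod u h = inner_prod v h.
  move=> uL vL uv hH; apply/eqP; rewrite -subr_eq0 -inner_prodBl//; last exact: H2_L2.
  rewrite inner_prodC; [|exact: H2_L2|exact: L2B].
  rewrite inner_prod_H2_eq0 ?conjC0//; first exact: L2B.
  by move=> k; rewrite fourier_coefB// uv subrr.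
exists (fun t => p t - alpha t * q t); split.
  apply: modelP; first by apply: H2B => //; exact: H2_inner_mul.
  move=> h hH; have hL := H2_L2 hH; have ahL := L2_inner_mul hL.
  rewrite inner_prodBl// inner_prod_inner_mul//.
  rewrite -(ortho _ _ _ fL pL pf); last exact: H2_inner_mul.
  rewrite -(ortho _ _ _ fJL qL qf)//.
  have -> : inner_prod f (fun t => alpha t * h t) = inner_prod (fun t => (alpha t)^* * f t) h.
    by rewrite inner_prod_mulr; congr inner_prod; apply/funext => t; rewrite conjCK.
  by rewrite subrr.
move=> h hK; have hL := model_L2 hK.
rewrite (_ : (fun t => _) = (fun t => (f t - p t) + alpha t * q t)); last first.
  by apply/funext => t; ring.
rewrite inner_prodDl//; last exact: L2B.
rewrite model_ortho_l// addr0 inner_prodBl//.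
by rewrite (ortho _ _ _ fL pL pf) ?subrr//; exact: model_H2.
Qed.

Lemma oproj_modelP f : L2 f -> K (oproj K f) /\
  forall h, K h -> inner_prod (fun t => f t - oproj K f t) h = 0.
Proof.
move=> fL; apply: (@xgetPex _ (fun=> 0) [set g | K g /\ forall h, K h ->
  inner_prod (fun t => f t - g t) h = 0]).
by have [g gP] := oproj_model_ex fL; exists g.
Qed.

Lemma oproj_model f : L2 f -> K (oproj K f). Proof. by move=> /oproj_modelP[]. Qed.

Lemma inner_prod_oproj f h : L2 f -> K h -> inner_prod (oproj K f) h = inner_prod f h.
Proof.
move=> fL hK; have [pK /(_ h hK)] := oproj_modelP fL.
rewrite inner_prodBl//; try exact: model_L2.
by move/eqP; rewrite subr_eq0 => /eqP.
Qed.

Lemma inner_prod_oprojr f h : L2 f -> K h -> inner_prod h (oproj K f) = inner_prod h f.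
Proof.
move=> fL hK; rewrite inner_prodC; [|exact/model_L2/oproj_model|exact: model_L2].
by rewrite inner_prod_oproj// -inner_prodC//; exact: model_L2.
Qed.

Definition backward_shift f t : C := zvar t ^ (-1) * (f t - fourier_coef f 0).

Lemma L2_sub_cst f (c : C) : L2 f -> L2 (fun t => f t - c).
Proof. by move=> fL; apply: L2B => //; exact: L2_cst. Qed.

Lemma H2_backward_shift f : H2 f -> H2 (backward_shift f).
Proof.
move=> [fL f0]; split; first by apply: L2_mul_zvarX; exact: L2_sub_cst.
move=> n n0; rewrite fourier_coef_zvarX_mul fourier_coefB ?fourier_coef_cst//; last exact: L2_cst.
have [->|nN1] := eqVneq n (-1); first by rewrite opprK addNr eqxx mulr1 subrr.
rewrite f0; last by lia.
by rewrite (_ : (n - -1 == 0) = false) ?mulr0 ?subrr//; lia.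
Qed.

(** z x has mean zero, so the subtracted constant f(0) does not contribute. *)
Lemma inner_prod_backward_shift x f : H2 x -> H2 f ->
  inner_prod x (backward_shift f) = inner_prod (fun t => zvar t ^ 1 * x t) f.
Proof.
move=> xH fH; have xL := H2_L2 xH; have fL := H2_L2 fH.
have zxH := H2_mul_zvar xH; have zxL := H2_L2 zxH.
have -> : inner_prod x (backward_shift f) =
    inner_prod (fun t => zvar t ^ 1 * x t) (fun t => f t - fourier_coef f 0).
  rewrite inner_prod_mulr; congr inner_prod; apply/funext => t.
  by rewrite conj_zvarX.
rewrite inner_prodBr//; last exact: L2_cst.
rewrite (_ : (fun=> fourier_coef f 0) = (fun t => fourier_coef f 0 * zvar t ^ 0)).
  rewrite inner_prodZr//; last exact: L2_zvarX.
  have -> : inner_prod (fun t => zvar t ^ 1 * x t) (fun t => zvar t ^ 0) = 0.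
    rewrite -/(fourier_coef _ _) fourier_coef_zvarX_mul.
    by have [_ ->] := xH.
  by rewrite mulr0 subr0.
by apply/funext => t; rewrite expr0z mulr1.
Qed.

(** The pairing of S^*f with alpha h is that of [f] with alpha (z h), and z h is again in H^2. *)
Lemma model_backward_shift f : K f -> K (backward_shift f).
Proof.
move=> fK; have fH := model_H2 fK; apply: modelP; first exact: H2_backward_shift.
move=> h hH; have ahH := H2_inner_mul hH.
rewrite inner_prodC; [|exact: H2_L2|exact/H2_L2/H2_backward_shift].
rewrite inner_prod_backward_shift//.
rewrite (_ : (fun t => _) = (fun t => alpha t * (zvar t ^ 1 * h t))).
  by rewrite model_ortho_l ?conjC0//; exact: H2_mul_zvar.
by apply/funext => t; ring.
Qed.

Lemma model_compressed_shift f : K f -> K (compressed_shift alpha f).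
Proof.
move=> fK; apply: oproj_model.
by have /H2_L2 := H2_mul_zvar (model_H2 fK); under eq_fun do rewrite expr1z.
Qed.

Lemma inner_prod_compressed_shift f h : K f -> K h ->
  inner_prod (compressed_shift alpha f) h = inner_prod f (backward_shift h).
Proof.
move=> fK hK; rewrite inner_prod_oproj//; last first.
  by have /H2_L2 := H2_mul_zvar (model_H2 fK); under eq_fun do rewrite expr1z.
rewrite inner_prod_backward_shift; try exact: model_H2.
by under [in RHS]eq_fun do rewrite expr1z.
Qed.

(** [backward_shift f] shows that the set from which [xget] chooses is inhabited. Its members have
    equal inner products with the whole model space, so they agree a.e. *)
Lemma compressed_shift_adjP f : K f ->
  K (compressed_shift_adj alpha f) /\
  compressed_shift_adj alpha f = backward_shift f %[ae mu].
Proof.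
move=> fK; have bK := model_backward_shift fK.
have [aK aP] : K (compressed_shift_adj alpha f) /\ forall h, K h ->
    inner_prod (compressed_shift alpha h) f = inner_prod h (compressed_shift_adj alpha f).
  apply: (@xgetPex _ (fun=> 0) [set g | K g /\ forall h, K h ->
    inner_prod (compressed_shift alpha h) f = inner_prod h g]).
  exists (backward_shift f); split => // h hK; exact: inner_prod_compressed_shift.
split => //.
have : (fun t => compressed_shift_adj alpha f t - backward_shift f t) = (fun=> 0) %[ae mu].
  apply: model_eq0; first exact: modelB.
  move=> h hK; rewrite inner_prodC; [|exact: model_L2|by apply: model_L2; exact: modelB].
  rewrite inner_prodBr; try exact: model_L2.
  by rewrite -aP// inner_prod_compressed_shift// subrr conjC0.
by apply: ae_imp => t h /h /eqP; rewrite subr_eq0 => /eqP.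
Qed.

(* The reproducing kernel at the origin. *)
Definition kernel0 t : C := 1 - (fourier_coef alpha 0)^* * alpha t.

(** Both <1, alpha h> and <conj(alpha(0)) alpha, alpha h> equal conj(alpha(0) h(0)): the first
    because the mean is multiplicative, the second because |alpha| = 1 a.e. *)
Lemma model_kernel0 : K kernel0.
Proof.
apply: modelP; first by apply: H2B; [exact: H2_cst|exact/H2Z/inner_H2].
move=> h hH; have ahL := L2_inner_mul (H2_L2 hH).
rewrite inner_prodBl//; [|exact: L2_cst|exact: L2Z].
rewrite inner_prodZl//.
have -> : inner_prod alpha (fun t => alpha t * h t) = (fourier_coef h 0)^*.
  rewrite (_ : inner_prod alpha _ = inner_prod (fun t => alpha t * zvar t ^ 0)
    (fun t => alpha t * h t)).
    rewrite inner_prod_inner_mul; [|exact: L2_zvarX|exact: H2_L2].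
    by rewrite inner_prodC; [|exact: H2_L2|exact: L2_zvarX].
  by congr inner_prod; apply/funext => t; rewrite expr0z mulr1.
rewrite (_ : (fun=> 1) = (fun t => zvar t ^ 0)) // inner_prodC//; last exact: L2_zvarX.
by rewrite -/(fourier_coef _ _) fourier_coef_inner_mul0// conjCM subrr.
Qed.

Lemma inner_prod_kernel0 f : K f -> inner_prod f kernel0 = fourier_coef f 0.
Proof.
move=> fK; have fL := model_L2 fK.
rewrite inner_prodBr//; [|exact: L2_cst|exact: L2Z].
rewrite inner_prodZr// (_ : inner_prod f alpha = 0) ?mulr0 ?subr0.
  by rewrite (_ : (fun=> 1) = (fun t => zvar t ^ 0)).
have := model_ortho fK (H2_cst (1 : C)).
by under eq_fun do rewrite mulr1.
Qed.

End ModelSpaces.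

(** * Values in the disk and bounded functions *)

Section DiskValues.
Variable R : realType.
Local Notation C := R[i].
Local Notation mu := (@circle_measure R).
Local Notation zvar := (@zvar R).
Implicit Types (f g h : R -> C) (w : C).

Lemma zvarXD t (m n : int) : zvar t ^ (m + n) = zvar t ^ m * zvar t ^ n.
Proof. by apply: expfzDr; exact: zvar_neq0. Qed.

Lemma cvg_normc (u : nat -> C^o) (l : C^o) :
  normc (u n - l) @[n --> \oo] --> (0 : R) -> u n @[n --> \oo] --> l.
Proof.
move=> /cvgrPdist_lt u0; apply/cvgrPdist_lt => e e0.
(* A positive element of [C] is real, so the complex-valued epsilon reduces to its real part. *)
have eE : e = (complex.Re e)%:C.
  by move: e0; case: e => a b; rewrite ltcE /= => /andP[/eqP -> _].
have r0 : 0 < complex.Re e by move: e0; rewrite ltcE => /andP[].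
have := u0 _ r0; apply: filterS => n.
rewrite sub0r normrN ger0_norm ?normc_nneg// => un.
have -> : `|l - u n| = (normc (l - u n))%:C by [].
by rewrite eE ltcR -normcN opprB.
Qed.

Definition disk_sum f w N : C := \sum_(i < N) fourier_coef f i%:Z * w ^+ i.

Lemma disk_value_eq f w (l : C) :
  normc (disk_sum f w N - l) @[N --> \oo] --> (0 : R) -> disk_value f w = l.
Proof.
move=> h; apply: (cvg_lim (@norm_hausdorff C C^o)).
have := @cvg_normc (disk_sum f w) l h.
rewrite (_ : disk_sum f w = (series (fun n : nat => fourier_coef f n%:Z * w ^+ n) : nat -> C^o))//.
by apply/funext => n; rewrite /disk_sum /series /= big_mkord.
Qed.

Lemma L2norm_zvarX (n : int) : L2norm (fun t => zvar t ^ n) = 1.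
Proof.
apply/eqP; rewrite -(@eqrXn2 _ 2) ?L2norm_ge0//; apply/eqP; apply: (@complexI R).
by rewrite -inner_prod_self expr1n; have := fourier_coef_zvarX R n n; rewrite eqxx.
Qed.

Lemma normc_fourier_coef f n : L2 f -> normc (fourier_coef f n) <= L2norm f.
Proof.
move=> fL; rewrite -[leRHS]mulr1 -(L2norm_zvarX n).
by apply: cauchy_schwarz => //; exact: L2_zvarX.
Qed.

Lemma geometric_sum_le (r : R) (m n : nat) : 0 <= r < 1 -> (m <= n)%N ->
  \sum_(m <= i < n) r ^+ i <= r ^+ m / (1 - r).
Proof.
move=> /andP[r0 r1] mn; rewrite ler_pdivlMr ?subr_gt0//.
rewrite -(subnKC mn).
have -> : (\sum_(m <= i < m + (n - m)) r ^+ i) * (1 - r) = r ^+ m - r ^+ n.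
  rewrite -{2}(subnKC mn); elim: (n - m)%N => [|k ih].
    by rewrite addn0 big_geq// mul0r subrr.
  by rewrite addnS big_nat_recr ?leq_addr//= mulrDl ih exprS; ring.
by rewrite gerBl exprn_ge0.
Qed.

Lemma disk_sum_dist f w (m n : nat) : L2 f -> normc w < 1 -> (m <= n)%N ->
  normc (disk_sum f w n - disk_sum f w m) <= L2norm f * (normc w ^+ m / (1 - normc w)).
Proof.
move=> fL w1 mn.
have -> : disk_sum f w n - disk_sum f w m =
    \sum_(m <= i < n) fourier_coef f i%:Z * w ^+ i.
  rewrite /disk_sum -!(big_mkord xpredT (fun i => fourier_coef f i%:Z * w ^+ i)).
  by rewrite (big_cat_nat _ mn)//= addrC addrK.
rewrite -{1}(add0n m) big_addn big_mkord; apply: le_trans (normc_sum _) _.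
apply: (@le_trans _ _ (\sum_(i < n - m) L2norm f * normc w ^+ (i + m))).
  apply: ler_sum => i _; rewrite normcM normcX ler_wpM2r ?exprn_ge0 ?normc_nneg//.
  exact: normc_fourier_coef.
rewrite -mulr_sumr ler_wpM2l ?L2norm_ge0//.
apply: le_trans (geometric_sum_le _ mn); last by rewrite normc_nneg.
by rewrite -[X in _ <= \sum_(X <= _ < _) _](add0n m) big_addn big_mkord.
Qed.

(** Meant for [q] the real or the imaginary part: it reduces the power series to real series
    dominated by a geometric one. *)
Lemma is_cvg_real_part (q : C -> R) f w : (forall z, `|q z| <= normc z) ->
  (forall z z', q (z + z') = q z + q z') -> L2 f -> normc w < 1 ->
  cvgn (fun N => q (disk_sum f w N)).
Proof.
move=> qn qD fL w1.
have q0 : q 0 = 0 by apply/eqP; rewrite -normr_le0 (le_trans (qn 0))// normc0.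
have qE : (fun N => q (disk_sum f w N)) = series (fun i => q (fourier_coef f i%:Z * w ^+ i)).
  apply/funext; elim => [|n ih].
    by rewrite /disk_sum big_ord0 /series /= big_geq.
  by rewrite /disk_sum big_ord_recr /= qD -/(disk_sum f w n) ih /series /= big_nat_recr.
rewrite qE; apply: normed_cvg.
apply: (@series_le_cvg _ _ (fun i => L2norm f * normc w ^+ i)).
- by move=> n /=.
- by move=> n; rewrite mulr_ge0 ?L2norm_ge0 ?exprn_ge0 ?normc_nneg.
- move=> n /=; apply: le_trans (qn _) _; rewrite normcM normcX.
  by rewrite ler_wpM2r ?exprn_ge0 ?normc_nneg// normc_fourier_coef.
apply: (@is_cvg_geometric_series R (L2norm f) (normc w)).
by rewrite ger0_norm ?normc_nneg.
Qed.

Lemma disk_value_cvg f w : L2 f -> normc w < 1 ->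
  normc (disk_sum f w N - disk_value f w) @[N --> \oo] --> (0 : R).
Proof.
move=> fL w1.
have cr : cvgn (fun N => complex.Re (disk_sum f w N)).
  by apply: is_cvg_real_part => //; [exact: ler_Re_normc|exact: ReD].
have ci : cvgn (fun N => complex.Im (disk_sum f w N)).
  by apply: is_cvg_real_part => //; [exact: ler_Im_normc|exact: ImD].
pose a := limn (fun N => complex.Re (disk_sum f w N)).
pose b := limn (fun N => complex.Im (disk_sum f w N)).
suff h : normc (disk_sum f w N - (a +i* b)) @[N --> \oo] --> (0 : R).
  by rewrite (disk_value_eq h).
have sumcv : `|complex.Re (disk_sum f w N) - a| + `|complex.Im (disk_sum f w N) - b|
    @[N --> \oo] --> (0 : R).
  rewrite -[X in _ --> X](addr0 0); apply: cvgD; apply/norm_cvg0P.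
    by rewrite -[X in _ --> X](subrr a); apply: cvgB => //; exact: cvg_cst.
  by rewrite -[X in _ --> X](subrr b); apply: cvgB => //; exact: cvg_cst.
apply: (squeeze_cvgr _ (cvg_cst (0 : R)) sumcv); apply: nearW => N.
rewrite normc_nneg /=; case: (disk_sum f w N) => x y /=.
move: (x - a) (y - b) => {}x {}y.
rewrite -[leRHS]ger0_norm ?addr_ge0// -sqrtr_sqr ler_wsqrtr// sqrrD.
rewrite !real_normK ?num_real//.
by rewrite lerD2r lerDl mulrn_wge0// mulr_ge0.
Qed.

Lemma disk_value_tail f w N : L2 f -> normc w < 1 ->
  normc (disk_value f w - disk_sum f w N) <= L2norm f * (normc w ^+ N / (1 - normc w)).
Proof.
move=> fL w1; have h := disk_value_cvg fL w1.
have h2 : normc (disk_sum f w M - disk_value f w) +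
   L2norm f * (normc w ^+ N / (1 - normc w)) @[M --> \oo] -->
   0 + L2norm f * (normc w ^+ N / (1 - normc w)).
  by apply: cvgD => //; exact: cvg_cst.
rewrite add0r in h2.
have : \forall M \near \oo, normc (disk_value f w - disk_sum f w N) <=
   normc (disk_sum f w M - disk_value f w) + L2norm f * (normc w ^+ N / (1 - normc w)).
  exists N => // M /= NM; apply: le_trans (_ : normc (disk_sum f w M - disk_value f w) +
    normc (disk_sum f w M - disk_sum f w N) <= _).
    rewrite -[X in _ <= X + _]normcN opprB; apply: le_trans (le_normcD _ _).
    by rewrite addrA subrK.
  by rewrite lerD2l; exact: disk_sum_dist.
by move=> /(limr_ge (cvgP _ h2)); rewrite (cvg_lim (@Rhausdorff R) h2).
Qed.

Lemma normc_disk_value f w : L2 f -> normc w < 1 ->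
  normc (disk_value f w) <= L2norm f / (1 - normc w).
Proof.
move=> fL w1; have := disk_value_tail 0 fL w1.
by rewrite /disk_sum big_ord0 subr0 expr0 mul1r.
Qed.

Lemma disk_value0 f : disk_value f 0 = fourier_coef f 0.
Proof.
apply: disk_value_eq; apply: cvg_near_cst; exists 1%N => // -[//|n] _.
rewrite /disk_sum big_ord_recl /= expr0 mulr1 big1 ?addr0 ?subrr ?normc0// => i _.
by rewrite expr0n mulr0.
Qed.

Lemma disk_valueD f g w : L2 f -> L2 g -> normc w < 1 ->
  disk_value (fun t => f t + g t) w = disk_value f w + disk_value g w.
Proof.
move=> fL gL w1; apply: disk_value_eq.
have h : normc (disk_sum f w N - disk_value f w) + normc (disk_sum g w N - disk_value g w)
    @[N --> \oo] --> (0 : R).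
  by rewrite -[X in _ --> X](addr0 0); apply: cvgD; exact: disk_value_cvg.
apply: (squeeze_cvgr _ (cvg_cst (0 : R)) h); apply: nearW => N.
rewrite normc_nneg /=; apply: le_trans (le_normcD _ _).
have -> : disk_sum (fun t => f t + g t) w N = disk_sum f w N + disk_sum g w N.
  by rewrite -big_split /=; apply: eq_bigr => i _; rewrite fourier_coefD// mulrDl.
by rewrite opprD addrACA.
Qed.

Lemma disk_valueZ (c : C) f w : L2 f -> normc w < 1 ->
  disk_value (fun t => c * f t) w = c * disk_value f w.
Proof.
move=> fL w1; apply: disk_value_eq.
have h : normc c * normc (disk_sum f w N - disk_value f w) @[N --> \oo] --> (0 : R).
  rewrite -[X in _ --> X](mulr0 (normc c)); apply: cvgM; first exact: cvg_cst.
  exact: disk_value_cvg.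
apply: (squeeze_cvgr _ (cvg_cst (0 : R)) h); apply: nearW => N.
rewrite normc_nneg /= -normcM mulrBr.
rewrite (_ : disk_sum _ w N = c * disk_sum f w N)//.
by rewrite mulr_sumr; apply: eq_bigr => i _; rewrite fourier_coefZ// mulrA.
Qed.

Lemma disk_value_mul_zvar f w : H2 f -> normc w < 1 ->
  disk_value (fun t => zvar t ^ 1 * f t) w = w * disk_value f w.
Proof.
(* Multiplication by z raises indices by one, so N+1 terms here match N terms for [f]; the extra
   constant term is the coefficient of [f] of index -1, which is 0. *)
move=> fH w1; apply: disk_value_eq; rewrite -cvg_shiftS.
have h : normc w * normc (disk_sum f w N - disk_value f w) @[N --> \oo] --> (0 : R).
  rewrite -[X in _ --> X](mulr0 (normc w)); apply: cvgM; first exact: cvg_cst.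
  by apply: disk_value_cvg => //; exact: H2_L2.
apply: (squeeze_cvgr _ (cvg_cst (0 : R)) h); apply: nearW => N.
rewrite normc_nneg /= -normcM mulrBr.
rewrite (_ : disk_sum _ w N.+1 = w * disk_sum f w N)//.
rewrite /disk_sum big_ord_recl /= fourier_coef_zvarX_mul sub0r.
have [_ ->//] := fH; rewrite mul0r add0r mulr_sumr; apply: eq_bigr => i _.
rewrite fourier_coef_zvarX_mul /bump /= add1n exprS.
have -> : i.+1%:Z - 1 = i%:Z by lia.
ring.
Qed.

Lemma disk_value_cst (c w : C) : normc w < 1 -> disk_value (fun=> c) w = c.
Proof.
move=> w1; apply: disk_value_eq; apply: cvg_near_cst; exists 1%N => // -[//|n] _.
rewrite /disk_sum big_ord_recl /= fourier_coef_cst eqxx expr0 !mulr1.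
rewrite big1 ?addr0 ?subrr ?normc0// => i _.
by rewrite fourier_coef_cst (_ : (_ == 0) = false) ?mulr0 ?mul0r.
Qed.

Lemma Hinfty_H2 f : Hinfty f -> H2 f. Proof. by case. Qed.

Lemma HinftyD f g : Hinfty f -> Hinfty g -> Hinfty (fun t => f t + g t).
Proof.
move=> [fH [M fM]] [gH [N gN]]; split; first exact: H2D.
exists (M + N) => w w1; rewrite disk_valueD//; try exact: H2_L2.
apply: le_trans (le_normcD _ _) _; apply: lerD; [exact: fM|exact: gN].
Qed.

Lemma HinftyZ (c : C) f : Hinfty f -> Hinfty (fun t => c * f t).
Proof.
move=> [fH [M fM]]; split; first exact: H2Z.
exists (normc c * M) => w w1; rewrite disk_valueZ//; last exact: H2_L2.
by rewrite normcM ler_wpM2l ?normc_nneg ?fM.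
Qed.

Lemma Hinfty_cst (c : C) : Hinfty (fun=> c).
Proof.
by split; [exact: H2_cst|exists (normc c) => w w1; rewrite disk_value_cst].
Qed.

Lemma Hinfty_mul_zvar f : Hinfty f -> Hinfty (fun t => zvar t ^ 1 * f t).
Proof.
move=> [fH [M fM]]; split; first exact: H2_mul_zvar.
exists M => w w1; rewrite disk_value_mul_zvar// normcM.
apply: le_trans (fM w w1); rewrite -[leRHS]mul1r ler_wpM2r ?normc_nneg//.
exact: ltW.
Qed.

Lemma Hinfty_sum n (F : 'I_n -> R -> C) : (forall i, Hinfty (F i)) ->
  Hinfty (fun t => \sum_(i < n) F i t).
Proof.
elim: n F => [|n ih] F FL.
  by under eq_fun do rewrite big_ord0; exact: Hinfty_cst.
under eq_fun do rewrite big_ord_recr /=.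
by apply: HinftyD; [apply: ih => i|]; exact: FL.
Qed.

Lemma Hinfty_mul_zpoly f c N : Hinfty f -> Hinfty (fun t => f t * zpoly c N t).
Proof.
move=> fH; have fzH k : Hinfty (fun t => zvar t ^ k%:Z * f t).
  elim: k => [|k ih]; first by under eq_fun do rewrite expr0z mul1r.
  have := Hinfty_mul_zvar ih; congr Hinfty; apply/funext => t.
  by rewrite mulrA -zvarXD -PoszD add1n.
have := @Hinfty_sum N (fun i t => c i * (zvar t ^ i%:Z * f t)) (fun i => HinftyZ _ (fzH i)).
congr Hinfty; apply/funext => t; rewrite /zpoly mulr_sumr.
by apply: eq_bigr => i _; ring.
Qed.

(** For |w| > 1/2, divide w (S^*f)(w) = f(w) - f(0) by w, which costs a factor 2. For |w| <= 1/2
    that division is useless, and the geometric bound ||S^*f|| / (1 - |w|) takes over, again with a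
    factor 2. *)
Lemma Hinfty_backward_shift f : Hinfty f -> Hinfty (backward_shift f).
Proof.
move=> [fH [M fM]]; have bH := H2_backward_shift fH; have bL := H2_L2 bH.
have zbL := H2_L2 (H2_mul_zvar bH).
split => //; pose B := M + normc (fourier_coef f 0).
exists (2 * B + 2 * L2norm (backward_shift f)) => w w1.
have B0 : 0 <= B.
  apply: addr_ge0 (normc_nneg _); apply: le_trans (fM w w1); exact: normc_nneg.
have n0 := L2norm_ge0 (backward_shift f).
have [w2|w2] := leP (normc w) 2^-1.
  apply: le_trans (normc_disk_value bL w1) _; rewrite ler_pdivrMr ?subr_gt0//.
  by have := normc_nneg w; nra.
have : normc w * normc (disk_value (backward_shift f) w) <= B.
  rewrite -normcM -disk_value_mul_zvar//.
  have -> : disk_value (fun t => zvar t ^ 1 * backward_shift f t) w =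
      disk_value f w - fourier_coef f 0.
    have fE : f = (fun t => zvar t ^ 1 * backward_shift f t + fourier_coef f 0).
      apply/funext => t.
      by rewrite /backward_shift mulrA -zvarXD subrr expr0z mul1r subrK.
    rewrite [X in _ = X - _](congr1 (fun u => disk_value u w) fE).
    by rewrite disk_valueD ?disk_value_cst ?addrK//; exact: L2_cst.
  by apply: le_trans (normcB _ _) _; rewrite lerD2r fM.
by have := normc_nneg (disk_value (backward_shift f) w); nra.
Qed.

End DiskValues.

(** * Boundary values of bounded analytic functions *)

Section BoundaryValues.
Variable R : realType.
Local Notation C := R[i].
Local Notation mu := (@circle_measure R).
Local Notation zvar := (@zvar R).
Implicit Types (f g h : R -> C).

Lemma L2norm_le f g : L2 f -> L2 g -> (forall t, normc (f t) <= normc (g t)) ->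
  L2norm f <= L2norm g.
Proof.
move=> fL gL fg; rewrite -(@ler_pXn2r _ 2) ?nnegrE ?L2norm_ge0// !sqr_L2norm.
apply: le_Rintegral => //; try exact: L2_integrable.
by move=> t _; rewrite ler_pXn2r ?nnegrE ?normc_nneg.
Qed.

Lemma L2norm_cst (c : C) : L2norm (fun=> c) = normc c.
Proof.
rewrite (_ : (fun=> c) = (fun t => c * zvar t ^ 0)); last first.
  by apply/funext => t; rewrite expr0z mulr1.
by rewrite L2normZ ?L2norm_zvarX ?mulr1//; exact: L2_zvarX.
Qed.

Lemma L2norm_taylor f N : L2 f -> L2norm (taylor f N) <= L2norm f.
Proof.
move=> fL; rewrite -(@ler_pXn2r _ 2) ?nnegrE ?L2norm_ge0//.
by rewrite (taylor_pythagoras N fL) lerDr sqr_ge0.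
Qed.

Lemma L2norm_zpoly_le (c d : nat -> C) N : (forall i, (i < N)%N -> normc (c i) <= normc (d i)) ->
  L2norm (zpoly c N) <= L2norm (zpoly d N).
Proof.
move=> cd; rewrite -(@ler_pXn2r _ 2) ?nnegrE ?L2norm_ge0// !sqr_L2norm_zpoly.
by apply: ler_sum => i _; rewrite ler_pXn2r ?nnegrE ?normc_nneg// cd.
Qed.

Lemma cmeas_real (g : R -> R) : measurable_fun [set: R] g -> cmeas (fun t => (g t)%:C).
Proof. by move=> mg; split => //=; exact: measurable_cst. Qed.

(* Truncated dilates [f_r] with [f_r(z) = f(rz)] approximate [f] in norm and
   inherit the bound of [f] on the disk. *)
Lemma bounded_approx f (M e : R) : H2 f -> 0 < e <= 1 ->
  (forall w, normc w < 1 -> normc (disk_value f w) <= M) ->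
  exists p, [/\ L2 p, forall t, normc (p t) <= M + e &
    L2norm (fun t => f t - p t) <= 4 * e].
Proof.
move=> fH /andP[e0 e1] fM; have fL := H2_L2 fH; have n0 := L2norm_ge0 f.
have /cvgrPdist_le /(_ e e0) [K _ KP] := taylor_cvg fH.
have tK n : (K <= n)%N -> L2norm (fun t => taylor f n t - f t) <= e.
  by move=> /KP /=; rewrite sub0r normrN ger0_norm ?L2norm_ge0.
(* [eta] will bound the relative change of the first K coefficients; the choice makes
   [eta ||f|| <= e], also when [f] vanishes. *)
pose eta := e / (1 + L2norm f).
have eta0 : 0 < eta by rewrite divr_gt0//; lra.
have eta1 : eta <= 1 by rewrite ler_pdivrMr; lra.
have etaf : eta * L2norm f <= e.
  by rewrite /eta mulrAC ler_pdivrMr ?ler_wpM2l//; lra.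
(* The radius is r = 1 - x; Bernoulli gives [1 - r^i <= i x <= eta] for i < K. *)
pose x := eta / K.+1%:R.
have K0 : 0 < K.+1%:R :> R by rewrite ltr0n.
have x0 : 0 < x by rewrite divr_gt0.
have x1 : x <= 1 by rewrite ler_pdivrMr// mul1r (le_trans eta1)// ler1n.
have xK i : (i < K)%N -> 1 - (1 - x) ^+ i <= eta.
  move=> iK; have x01 : 0 <= x <= 1 by rewrite ltW.
  have := bernoulli_ineq i x01; have : i%:R * x <= eta.
    rewrite /x mulrA ler_pdivrMr// mulrC ler_wpM2l ?(ltW eta0)// ler_nat.
    by rewrite ltnW// ltnW.
  by move: ((1 - x) ^+ i) (i%:R * x) => u v; lra.
pose r := 1 - x; have r0 : 0 <= r by rewrite subr_ge0.
have r1 : r < 1 by rewrite /r; lra.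
have rX i : 0 <= r ^+ i <= 1 by rewrite exprn_ge0// exprn_ile1// ltW.
have tail0 : L2norm f * (r ^+ n / (1 - r)) @[n --> \oo] --> (0 : R).
  rewrite -[X in _ --> X](mulr0 (L2norm f)); apply: cvgM; first exact: cvg_cst.
  rewrite -[X in _ --> X](mul0r (1 - r)^-1); apply: cvgM; last exact: cvg_cst.
  by apply: cvg_expr; rewrite ger0_norm.
have /cvgrPdist_le /(_ e e0) [N0 _ NP] := tail0.
(* Beyond [N0] the discarded tail of f(rz) is at most [e] on the circle, so the truncation stays
   below M + e. *)
pose N := maxn K N0.
have tail : L2norm f * (r ^+ N / (1 - r)) <= e.
  by have := NP N (leq_maxr _ _); rewrite /= sub0r normrN; apply: le_trans; exact: ler_norm.
pose c i : C := fourier_coef f i%:Z * (r ^+ i)%:C.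
exists (zpoly c N); split; first exact: L2_zpoly.
  move=> t; have w1 : normc (r%:C * zvar t) = r.
    by rewrite normcM normc_zvar mulr1 normc_real ger0_norm.
  have -> : zpoly c N t = disk_sum f (r%:C * zvar t) N.
    by apply: eq_bigr => i _; rewrite exprMn -rmorphXn /c mulrA.
  have wlt : normc (r%:C * zvar t) < 1 by rewrite w1.
  have := disk_value_tail N fL wlt; rewrite w1 => tl.
  have h : disk_sum f (r%:C * zvar t) N = disk_value f (r%:C * zvar t) -
      (disk_value f (r%:C * zvar t) - disk_sum f (r%:C * zvar t) N) by rewrite opprB addrC subrK.
  rewrite h; apply: le_trans (normcB _ _) _; apply: lerD; first exact: fM.
  exact: le_trans tail.
(* [d] majorizes the coefficients of f_N - p: the factor 1 - r^i is at most eta below K and at most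
   1 from K on. This gives ||f_N - p|| <= ||f_N - f_K|| + eta ||f_K|| <= 3 e, and ||f - f_N|| adds
   the fourth [e]. *)
pose d i : C := if (i < K)%N then eta%:C * fourier_coef f i%:Z else fourier_coef f i%:Z.
have KN : (K <= N)%N by exact: leq_maxl.
have tL n : L2 (taylor f n) by exact: L2_zpoly.
have dist1 : L2norm (fun t => taylor f N t - zpoly c N t) <= L2norm (zpoly d N).
  rewrite (_ : (fun t => _) = zpoly (fun i => fourier_coef f i%:Z * (1 - r ^+ i)%:C) N).
    apply: L2norm_zpoly_le => i iN; rewrite normcM normc_real ger0_norm; last first.
      by rewrite subr_ge0; case/andP: (rX i).
    rewrite /d; case: ifPn => iK.
      by rewrite normcM normc_real ger0_norm ?(ltW eta0)// mulrC ler_wpM2r ?normc_nneg// xK.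
    rewrite -[leRHS]mulr1 ler_wpM2l ?normc_nneg// gerBl.
    by case/andP: (rX i).
  apply/funext => t; rewrite /taylor /zpoly -sumrB; apply: eq_bigr => i _.
  by rewrite /c rmorphB rmorph1; ring.
have dist2 : L2norm (zpoly d N) <= 2 * e + e.
  have -> : zpoly d N = (fun t => (taylor f N t - taylor f K t) + eta%:C * taylor f K t).
    apply/funext => t; rewrite /taylor /zpoly.
    rewrite (big_ord_widen _ (fun i => fourier_coef f i%:Z * zvar t ^ i%:Z) KN).
    rewrite [X in _ - X]big_mkcond [X in _ * X]big_mkcond /= mulr_sumr -sumrB -big_split /=.
    apply: eq_bigr => i _; rewrite /d; case: ifPn => iK; last by rewrite subr0 mulr0 addr0.
    by rewrite subrr add0r mulrA.
  apply: le_trans (L2normD _ _) _; [exact: L2B|exact: L2Z|].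
  apply: lerD.
    apply: le_trans (L2norm_triangle (tL N) fL (tL K)) _.
    have := tK N KN; have := tK K (leqnn K); rewrite (L2norm_distC fL (tL K)); lra.
  rewrite L2normZ// normc_real ger0_norm ?(ltW eta0)//.
  by apply: le_trans etaf; rewrite ler_wpM2l ?(ltW eta0)// L2norm_taylor.
apply: le_trans (L2norm_triangle fL (tL N) (L2_zpoly c N)) _.
by have := tK N KN; rewrite (L2norm_distC fL (tL N)); lra.
Qed.

(** The excess [E] of |f| over M is pointwise at most |f - p| + e for the approximant p of
    [bounded_approx]; its norm is then at most 4 e + e for all small [e], hence 0. *)
Lemma Hinfty_ae_bounded f : Hinfty f -> exists M, {ae mu, forall t, normc (f t) <= M}.
Proof.
move=> [fH [M fM]]; have fL := H2_L2 fH; exists M.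
have M0 : 0 <= M by apply: le_trans (fM 0 _); rewrite ?normc_nneg ?normc0.
pose E t := Num.max 0 (normc (f t) - M).
have E0 t : 0 <= E t by rewrite le_max lexx.
have mE : cmeas (fun t => (E t)%:C).
  apply: cmeas_real; apply: measurable_maxr => //; apply: measurable_funB => //.
  by apply: measurable_normc; exact: L2_cmeas.
have EL : L2 (fun t => (E t)%:C).
  apply: (L2_le mE (L2_integrable fL)); apply: ae_all => t.
  rewrite normc_real ger0_norm// ler_pXn2r ?nnegrE ?normc_nneg// ge_max normc_nneg.
  by rewrite gerBl.
have small (e : R) : 0 < e <= 1 -> L2norm (fun t => (E t)%:C) <= 5 * e.
  move=> e01; have [p [pL pM fp]] := bounded_approx fH e01 fM.
  have /andP[e0 _] := e01; have fpL := L2B fL pL.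
  have hm : measurable_fun [set: R] (fun t => normc (f t - p t)).
    by apply: measurable_normc; exact: L2_cmeas.
  have hL : L2 (fun t => (normc (f t - p t))%:C).
    apply: (L2_le _ (L2_integrable fpL)); first exact: cmeas_real.
    by apply: ae_all => t; rewrite normc_real ger0_norm ?normc_nneg.
  apply: (@le_trans _ _ (L2norm (fun t => (normc (f t - p t))%:C + e%:C))).
    apply: L2norm_le => //; first by apply: L2D => //; exact: L2_cst.
    move=> t; rewrite -rmorphD !normc_real !ger0_norm//; last first.
      by rewrite addr_ge0 ?normc_nneg// ltW.
    rewrite ge_max addr_ge0 ?normc_nneg ?(ltW e0)//= lerBlDr.
    have := pM t; have := le_normcD (f t - p t) (p t); rewrite subrK; lra.
  apply: le_trans (L2normD hL (L2_cst e%:C)) _.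
  rewrite L2norm_cst normc_real ger0_norm ?(ltW e0)//.
  have : L2norm (fun t => (normc (f t - p t))%:C) <= L2norm (fun t => f t - p t).
    by apply: L2norm_le => // t; rewrite normc_real ger0_norm ?normc_nneg.
  lra.
have Ez : L2norm (fun t => (E t)%:C) = 0.
  apply/eqP; rewrite eq_le L2norm_ge0 andbT; apply/ler_addgt0Pr => e e0; rewrite add0r.
  (* The cap at 1 meets the range allowed by [bounded_approx]; the 5 undoes the factor in
     [small]. *)
  have e5 : 0 < Num.min 1 (e / 5) <= 1 by rewrite lt_min ltr01 divr_gt0//= ge_min lexx.
  apply: le_trans (small _ e5) _.
  have : Num.min 1 (e / 5) <= e / 5 by rewrite ge_min lexx orbT.
  lra.
have := L2norm_eq0 EL Ez; apply: ae_imp => t /(_ I) [] Et.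
have : normc (f t) - M <= E t by rewrite le_max lexx orbT.
by rewrite Et subr_le0.
Qed.

End BoundaryValues.

(** * Density of bounded functions in a model space *)

Section Density.
Variable R : realType.
Local Notation C := R[i].
Local Notation mu := (@circle_measure R).
Local Notation zvar := (@zvar R).
Implicit Types (f g h : R -> C).

Variable alpha : R -> C.
Hypothesis ia : inner_function alpha.
Local Notation K := (model_space alpha).
Local Notation Kinfty := (model_space_infty alpha).

(* Since [P_+ (conj alpha p)] is a polynomial for every polynomial [p], the
   projections [P_alpha p] are bounded, and they approximate [P_alpha f = f]. *)
Lemma model_dense f : K f -> exists2 u : nat -> R -> C,
  forall n, Kinfty (u n) & L2lim u f.
Proof.
move=> fK; have fH := model_H2 fK; have fL := H2_L2 fH; have aH := inner_H2 ia.
(* Cutting at N loses nothing: the k-th coefficient of conj(alpha) f_N combines the conjugates of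
   alpha^(i - k) with i < N, all zero once k >= N. So [q N] is the full Riesz projection and [u N]
   is P_alpha f_N. *)
pose q N := zpoly (fun k => fourier_coef (fun t => (alpha t)^* * taylor f N t) k%:Z) N.
pose u N t := taylor f N t - alpha t * q N t.
have tL N : L2 (taylor f N) by exact: L2_zpoly.
have qH N : H2 (q N) by exact: H2_zpoly.
have qL N := H2_L2 (qH N).
have aqL N := L2_inner_mul ia (qL N).
have uK N : K (u N).
  apply: modelP.
    by apply: H2B; [exact: H2_zpoly|exact: H2_inner_mul].
  move=> h hH; have hL := H2_L2 hH; have ahL := L2_inner_mul ia hL.
  have atL := L2_inner_mulJ ia (tL N).
  rewrite /u (inner_prodBl (tL N) (aqL N) ahL) (inner_prod_inner_mul ia (qL N) hL).
  have -> : inner_prod (taylor f N) (fun t => alpha t * h t) =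
      inner_prod (fun t => (alpha t)^* * taylor f N t) h.
    by rewrite inner_prod_mulr; congr inner_prod; apply/funext => t; rewrite conjCK.
  rewrite -inner_prodBl//; rewrite inner_prodC//; last exact: L2B.
  rewrite inner_prod_H2_eq0 ?conjC0//; first exact: L2B.
  move=> k; rewrite fourier_coefB// fourier_coef_zpoly_nat.
  case: ifPn => [_|]; first by rewrite subrr.
  rewrite -leqNgt subr0 => Nk; rewrite /fourier_coef inner_prod_mulr.
  rewrite inner_prod_zpolyl; last first.
    by under eq_fun do rewrite conjCK; apply: L2_inner_mul => //; exact: L2_zvarX.
  rewrite big1// => i _.
  rewrite (_ : (fun t => _) = (fun t => zvar t ^ k%:Z * alpha t)); last first.
    by apply/funext => t; rewrite conjCK mulrC.
  rewrite fourier_coef_zvarX_mul; have [_ ->] := aH; rewrite ?conjC0 ?mulr0//.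
  by have := ltn_ord i; lia.
exists u => [N|].
  split => //.
  have h1 := Hinfty_mul_zpoly (fun i => fourier_coef f i%:Z) N (Hinfty_cst (1 : C)).
  have h2 := HinftyZ (-1) (Hinfty_mul_zpoly
    (fun k => fourier_coef (fun t => (alpha t)^* * taylor f N t) k%:Z) N ia.1).
  have := HinftyD h1 h2; congr Hinfty; apply/funext => t.
  by rewrite mul1r mulN1r.
apply: (squeeze_cvgr _ (cvg_cst (0 : R)) (taylor_cvg fH)); apply: nearW => N.
rewrite L2norm_ge0 /=; have dK := modelB ia (uK N) fK.
have dL := model_L2 dK; have tfL := L2B (tL N) fL.
(* Contractivity of P_alpha by hand: alpha q_N is orthogonal to d = u_N - f, so ||d||^2 = <f_N - f,
   d>, and Cauchy-Schwarz allows one factor ||d|| to be cancelled. *)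
have : L2norm (fun t => u N t - f t) ^+ 2 <=
    L2norm (fun t => taylor f N t - f t) * L2norm (fun t => u N t - f t).
  apply: le_trans (cauchy_schwarz tfL dL).
  rewrite -[X in X <= _](ger0_norm (sqr_ge0 _)) -normc_real -inner_prod_self.
  rewrite le_eqVlt; apply/orP; left; apply/eqP; congr normc.
  rewrite {1}(_ : (fun t => u N t - f t) =
    (fun t => (taylor f N t - f t) - alpha t * q N t)); last first.
    by apply/funext => t; rewrite /u; ring.
  by rewrite (inner_prodBl tfL (aqL N) dL) (model_ortho_l ia dK (qH N)) subr0.
rewrite expr2; have [->|n0] := eqVneq (L2norm (fun t => u N t - f t)) 0.
  by rewrite L2norm_ge0.
by rewrite ler_pM2r// lt_def n0 L2norm_ge0.
Qed.

(** These two clauses give |L u_n - L f| <= B ||u_n - f||, which carries an identity from the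
    bounded functions u_n to their limit. Plain functions on representatives are covered, such as f
    |-> <A f, h>. *)
Definition bounded_functional (L : (R -> C) -> C) :=
  (forall f g, K f -> K g -> L (fun t => f t - g t) = L f - L g) /\
  exists B : R, forall f, K f -> normc (L f) <= B * L2norm f.

Lemma bounded_functionalB L L' : bounded_functional L -> bounded_functional L' ->
  bounded_functional (fun f => L f - L' f).
Proof.
move=> [LB [B LN]] [LB' [B' LN']]; split.
  by move=> f g fK gK; rewrite LB// LB'//; ring.
exists (B + B') => f fK; apply: le_trans (normcB _ _) _.
by rewrite mulrDl; apply: lerD; [exact: LN|exact: LN'].
Qed.

Lemma bounded_functionalZ L (c : C) : bounded_functional L ->
  bounded_functional (fun f => L f * c).
Proof.
move=> [LB [B LN]]; split; first by move=> f g fK gK; rewrite LB// mulrBl.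
exists (B * normc c) => f fK; rewrite normcM mulrAC.
by rewrite ler_wpM2r ?normc_nneg ?LN.
Qed.

Lemma bounded_functional_inner_prodl h : L2 h -> bounded_functional (fun f => inner_prod f h).
Proof.
move=> hL; split.
  by move=> f g fK gK; rewrite inner_prodBl//; exact: (@model_L2 _ alpha).
exists (L2norm h) => f fK; rewrite mulrC; apply: cauchy_schwarz => //; exact: (@model_L2 _ alpha).
Qed.

Lemma bounded_functional_inner_prodr h : L2 h -> bounded_functional (inner_prod h).
Proof.
move=> hL; split.
  by move=> f g fK gK; rewrite inner_prodBr//; exact: (@model_L2 _ alpha).
exists (L2norm h) => f fK; apply: cauchy_schwarz => //; exact: (@model_L2 _ alpha).
Qed.

Lemma bounded_functional_eq0 L f : bounded_functional L ->
  (forall g, Kinfty g -> L g = 0) -> K f -> L f = 0.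
Proof.
move=> [LB [B LN]] L0 fK; have [u uK uf] := model_dense fK.
apply: (@eq0_normc_le _ _ (fun n => B * L2norm (fun t => u n t - f t))).
  by rewrite -[X in _ --> X](mulr0 B); apply: cvgM => //; exact: cvg_cst.
apply: nearW => n; have [unK _] := uK n.
have := LN _ (modelB ia unK fK).
by rewrite LB// L0// sub0r normcN.
Qed.

Lemma model_eq0_infty f : K f -> (forall h, Kinfty h -> inner_prod f h = 0) ->
  f = (fun=> 0) %[ae mu].
Proof.
move=> fK f0; apply: (model_eq0 fK) => h hK.
by apply: bounded_functional_eq0 hK => //; apply: bounded_functional_inner_prodr; exact: (@model_L2 _ alpha).
Qed.

End Density.

(** * The shift defect of an operator *)

Section ShiftDefect.
Variable R : realType.
Local Notation C := R[i].
Local Notation mu := (@circle_measure R).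
Local Notation zvar := (@zvar R).
Implicit Types (f g h x : R -> C).

Lemma model_kernelE (gamma : R -> C) : model_kernel gamma 0 = kernel0 gamma.
Proof.
apply/funext => t; rewrite /model_kernel /kernel0 disk_value0.
by rewrite conjC0 mul0r subr0 divr1.
Qed.

Variables (alpha beta : R -> C) (A : (R -> C) -> (R -> C)).
Hypothesis ia : inner_function alpha.
Hypothesis ib : inner_function beta.
Hypothesis bA : bounded_operator (model_space alpha) (model_space beta) A.
Local Notation Ka := (model_space alpha).
Local Notation Kb := (model_space beta).
Local Notation bs := (@backward_shift R).

Let La f : Ka f -> L2 f := @model_L2 R alpha f.
Let Lb f : Kb f -> L2 f := @model_L2 R beta f.

Let AK f : Ka f -> Kb (A f). Proof. by case: bA => + _ _ _; exact. Qed.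

Lemma operatorB f g h : Ka f -> Ka g -> Kb h ->
  inner_prod (A (fun t => f t - g t)) h = inner_prod (A f) h - inner_prod (A g) h.
Proof.
move=> fK gK hK; have [_ _ lin _] := bA; have := lin (-1) g f gK fK.
have -> : (fun t => -1 * g t + f t) = (fun t => f t - g t).
  by apply/funext => t; rewrite mulN1r addrC.
move=> E; have BK := AK (modelB ia fK gK).
have AfL := Lb (AK fK); have AgL := Lb (AK gK).
rewrite -(inner_prodBl AfL AgL (Lb hK)); apply: inner_prod_ae => //.
- exact: Lb.
- exact: L2B.
- exact: Lb.
- exact: Lb.
- by apply: ae_imp E => t /[apply] ->; rewrite mulN1r addrC.
exact: ae_all.
Qed.

Lemma operator_bound : exists B : R, forall f, Ka f -> L2norm (A f) <= B * L2norm f.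
Proof. by case: bA. Qed.

Lemma L2norm_backward_shift f : L2 f -> L2norm (bs f) <= 2 * L2norm f.
Proof.
move=> fL; rewrite /backward_shift L2norm_zvarX_mul; last exact: L2_sub_cst.
apply: le_trans (L2normB fL (L2_cst _)) _; rewrite L2norm_cst.
by have := normc_fourier_coef 0 fL; lra.
Qed.

Lemma backward_shiftB f g : L2 f -> L2 g ->
  bs (fun t => f t - g t) = (fun t => bs f t - bs g t).
Proof.
move=> fL gL; apply/funext => t; rewrite /backward_shift fourier_coefB//.
by ring.
Qed.

Lemma bounded_functional_operator h : Kb h ->
  bounded_functional alpha (fun f => inner_prod (A f) h).
Proof.
move=> hK; split; first by move=> f g fK gK; exact: operatorB.
have [B BP] := operator_bound; exists (B * L2norm h) => f fK.
apply: le_trans (cauchy_schwarz (Lb (AK fK)) (Lb hK)) _.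
by rewrite mulrAC ler_wpM2r ?L2norm_ge0// BP.
Qed.

Lemma bounded_functional_shift L : bounded_functional alpha L ->
  bounded_functional alpha (fun f => L (bs f)).
Proof.
move=> [LB [B LN]]; split.
  move=> f g fK gK; rewrite backward_shiftB; [|exact: La|exact: La].
  by rewrite LB//; exact: (model_backward_shift ia).
(* The sign of [B] is unknown, and replacing ||S^*f|| by the larger 2 ||f|| requires a nonnegative
   factor. *)
exists (`|B| * 2) => f fK; apply: le_trans (LN _ (model_backward_shift ia fK)) _.
apply: (@le_trans _ _ (`|B| * L2norm (bs f))).
  by rewrite ler_wpM2r ?L2norm_ge0// ler_norm.
by rewrite -mulrA ler_wpM2l// L2norm_backward_shift//; exact: La.
Qed.

(** S_beta moves across the inner product as S^*, and since [A] respects a.e. equality the chosen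
    representative of S_alpha^* f may be replaced by the explicit one. *)
Lemma inner_prod_shift_defect f g : Ka f -> Kb g ->
  inner_prod (fun t => A f t -
    compressed_shift beta (A (compressed_shift_adj alpha f)) t) g =
  inner_prod (A f) g - inner_prod (A (bs f)) (bs g).
Proof.
move=> fK gK; have [sK sE] := compressed_shift_adjP ia fK.
have bK := model_backward_shift ia fK.
rewrite inner_prodBl; [|exact/Lb/AK|exact/Lb/(model_compressed_shift ib)/AK|exact: Lb].
rewrite inner_prod_compressed_shift//; last exact: AK.
congr (_ - _); apply: inner_prod_ae.
- exact/Lb/AK.
- exact/Lb/AK.
- exact/Lb/(model_backward_shift ib).
- exact/Lb/(model_backward_shift ib).
- by have [_ + _ _] := bA; apply.
exact: ae_all.
Qed.

(** The reproducing property at 0, used in both variables: <f, k_0> = f(0) and <k_0, g> =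
    conj(g(0)). *)
Lemma inner_prod_rank_two psi chi f g : Kb psi -> Ka chi -> Ka f -> Kb g ->
  inner_prod (fun t => rank_one psi (model_kernel alpha 0) f t +
    rank_one (model_kernel beta 0) chi f t) g =
  fourier_coef f 0 * inner_prod psi g + inner_prod f chi * (fourier_coef g 0)^*.
Proof.
move=> pK cK fK gK; rewrite !model_kernelE /rank_one.
have kK := model_kernel0 ib.
rewrite inner_prodDl; [|exact/L2Z/Lb|exact/L2Z/Lb|exact: Lb].
rewrite inner_prodZl; [|exact: Lb|exact: Lb].
rewrite inner_prodZl; [|exact: Lb|exact: Lb].
rewrite (inner_prod_kernel0 ia fK); congr (_ + _ * _).
rewrite inner_prodC; [|exact: Lb|exact: Lb].
by rewrite (inner_prod_kernel0 ib gK).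
Qed.

Lemma model_shift_defect f : Ka f -> Kb (fun t => A f t -
    compressed_shift beta (A (compressed_shift_adj alpha f)) t).
Proof.
move=> fK; have [sK sE] := compressed_shift_adjP ia fK.
by apply: (modelB ib); [exact: AK|exact/(model_compressed_shift ib)/AK].
Qed.

(** * From a symbol to the shift identity *)

Lemma L2_mul_Hinfty phi f : L2 phi -> Hinfty f -> L2 (fun t => phi t * f t).
Proof.
move=> pL fH; have [M fM] := Hinfty_ae_bounded fH.
have /(L2_mul_bounded (L2_cmeas (H2_L2 (Hinfty_H2 fH))) fM) := pL.
by under eq_fun do rewrite mulrC.
Qed.

(** The two factors z^-1 cancel on the circle, leaving <phi (f - f(0)), g - g(0)>. In its expansion
    the term f(0) phi^(0) conj(g(0)) is merged with -f(0) <phi, g>, since <phi^(0), g> = phi^(0)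
    conj(g(0)). *)
Lemma inner_prod_symbol_shift phi f g : L2 phi -> Hinfty f -> L2 g ->
  inner_prod (fun t => phi t * bs f t) (bs g) =
  inner_prod (fun t => phi t * f t) g
  - inner_prod f (fun t => (phi t)^*) * (fourier_coef g 0)^*
  - fourier_coef f 0 * inner_prod (fun t => phi t - fourier_coef phi 0) g.
Proof.
move=> pL fH gL; have fL := H2_L2 (Hinfty_H2 fH); have pfL := L2_mul_Hinfty pL fH.
set a := fourier_coef f 0; set b := fourier_coef g 0; set c := fourier_coef phi 0.
have cE (h : R -> C) (d : C) : L2 h -> inner_prod h (fun=> d) = fourier_coef h 0 * d^*.
  move=> hL; rewrite -(mulr1 d) (_ : (fun=> d * 1) = (fun t => d * zvar t ^ 0)).
    by rewrite inner_prodZr ?mulr1 1?mulrC//; exact: L2_zvarX.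
  by apply/funext => t; rewrite expr0z.
transitivity (inner_prod (fun t => phi t * f t - a * phi t) (fun t => g t - b)).
  rewrite /backward_shift -/a -/b.
  rewrite (_ : (fun t => phi t * (zvar t ^ (-1) * (f t - a))) =
    (fun t => zvar t ^ (-1) * (phi t * f t - a * phi t))).
    rewrite inner_prod_mulr; congr inner_prod; apply/funext => t.
    by rewrite mulrA zvar_mulJ subrr expr0z mul1r.
  by apply/funext => t; ring.
have apL := L2Z a pL; have bL := L2_cst b; have d1 := L2B pfL apL.
rewrite (inner_prodBr gL bL d1) (inner_prodBl pfL apL gL) (inner_prodZl a pL gL).
rewrite (inner_prodBl pL (L2_cst c) gL) (cE _ _ d1) (fourier_coefB _ pfL apL).
rewrite (fourier_coefZ _ _ pL) -/c.
have -> : fourier_coef (fun t => phi t * f t) 0 = inner_prod f (fun t => (phi t)^*).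
  rewrite /fourier_coef inner_prod_mulr; congr inner_prod; apply/funext => t.
  by rewrite expr0z mulr1.
have -> : inner_prod (fun=> c) g = c * b^*.
  rewrite (inner_prodC gL (L2_cst c)).
  by rewrite cE// conjCM conjCK mulrC.
ring.
Qed.

Lemma atto_shift_defect : ATTO alpha beta A ->
  exists psi chi : R -> C, [/\ Kb psi, Ka chi & forall f, Ka f ->
    (fun t => A f t - compressed_shift beta (A (compressed_shift_adj alpha f)) t) =
    (fun t => rank_one psi (model_kernel alpha 0) f t +
      rank_one (model_kernel beta 0) chi f t) %[ae mu]].
Proof.
move=> [_ [phi pL Aphi]].
have pcL : L2 (fun t => phi t - fourier_coef phi 0) by exact: L2_sub_cst.
have pJL := L2J pL.
pose psi := oproj Kb (fun t => phi t - fourier_coef phi 0).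
pose chi := oproj Ka (fun t => (phi t)^*).
have pK : Kb psi := oproj_model ib pcL.
have cK : Ka chi := oproj_model ia pJL.
exists psi, chi; split => // f fK.
have kK := model_kernel0 ib.
have rK : Kb (fun t => rank_one psi (model_kernel alpha 0) f t +
    rank_one (model_kernel beta 0) chi f t).
  by rewrite !model_kernelE /rank_one; apply: (modelD ib); exact: (modelZ ib).
have dK := model_shift_defect fK.
have Ainf u h : model_space_infty alpha u -> Kb h ->
    inner_prod (A u) h = inner_prod (fun t => phi t * u t) h.
  move=> uI hK; have [uK uH] := uI; have puL := L2_mul_Hinfty pL uH.
  rewrite -(inner_prod_oproj ib puL hK); apply: inner_prod_ae.
  - exact/Lb/AK.
  - exact/Lb/(oproj_model ib).
  - exact: Lb.
  - exact: Lb.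
  - exact: Aphi.
  exact: ae_all.
suff : (fun t => (A f t - compressed_shift beta (A (compressed_shift_adj alpha f)) t) -
    (rank_one psi (model_kernel alpha 0) f t + rank_one (model_kernel beta 0) chi f t))
    = (fun=> 0) %[ae mu].
  by apply: ae_imp => t /[apply] /eqP; rewrite subr_eq0 => /eqP.
apply: (model_eq0 (modelB ib dK rK)) => g gK.
rewrite (inner_prodBl (Lb dK) (Lb rK) (Lb gK)) inner_prod_shift_defect//.
rewrite inner_prod_rank_two// opprD addrA.
have bgK := model_backward_shift ib gK.
(* With [g] fixed, the difference of the two sides is a bounded functional of [u], so bounded [u]
   suffice; [g] stays arbitrary because only the products of [phi] with [u] and S^*u must be square
   integrable. *)
pose L u := inner_prod (A u) g - inner_prod (A (bs u)) (bs g)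
  - fourier_coef u 0 * inner_prod psi g - inner_prod u chi * (fourier_coef g 0)^*.
have bL : bounded_functional alpha L.
  apply: bounded_functionalB; last first.
    by apply: bounded_functionalZ; apply: bounded_functional_inner_prodl; exact: La.
  apply: bounded_functionalB; last first.
    apply: bounded_functionalZ; apply: bounded_functional_inner_prodl; exact: L2_zvarX.
  apply: bounded_functionalB; first exact: bounded_functional_operator.
  exact: (bounded_functional_shift (bounded_functional_operator bgK)).
apply: (bounded_functional_eq0 ia bL _ fK) => u uI; have [uK uH] := uI.
have buI : model_space_infty alpha (bs u).
  by split; [exact: (model_backward_shift ia)|exact: Hinfty_backward_shift].
rewrite /L !Ainf// (inner_prod_symbol_shift pL uH (Lb gK)).
rewrite (inner_prod_oproj ib pcL gK) (inner_prod_oprojr ia pJL uK).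
ring.
Qed.

(** * From the shift identity to a symbol *)

Lemma iter_model_shift (gamma : R -> C) n f : inner_function gamma ->
  model_space gamma f -> model_space gamma (iter n bs f).
Proof. by move=> ig fK; elim: n => //= n ih; exact: (model_backward_shift ig). Qed.

Lemma inner_prod_iter_shift (gamma : R -> C) n x f : inner_function gamma -> H2 x ->
  model_space gamma f ->
  inner_prod x (iter n bs f) = inner_prod (fun t => zvar t ^ n%:Z * x t) f.
Proof.
move=> ig + fK; elim: n x => [|n ih] x xH.
  by congr inner_prod; apply/funext => t; rewrite expr0z mul1r.
rewrite iterS inner_prod_backward_shift//; last exact/model_H2/(iter_model_shift n ig fK).
rewrite ih; last exact: H2_mul_zvar.
by congr inner_prod; apply/funext => t; rewrite mulrA -zvarXD -PoszD addn1.
Qed.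

Lemma fourier_coef_iter_shift (gamma : R -> C) n f : inner_function gamma ->
  model_space gamma f -> fourier_coef (iter n bs f) 0 = fourier_coef f n%:Z.
Proof.
move=> ig fK; have nL := model_L2 (iter_model_shift n ig fK).
rewrite /fourier_coef inner_prodC//; last exact: L2_zvarX.
rewrite (_ : (fun t => zvar t ^ 0) = (fun=> 1)); last by apply/funext => t; rewrite expr0z.
rewrite (inner_prod_iter_shift _ ig (H2_cst (1 : C)) fK).
rewrite (_ : (fun t => _) = (fun t => zvar t ^ n%:Z)); last first.
  by apply/funext => t; rewrite mulr1.
by rewrite -inner_prodC//; [exact: L2_zvarX|exact: model_L2 fK].
Qed.

Lemma iter_shiftE (gamma : R -> C) n f : inner_function gamma ->
  model_space gamma f ->
  (fun t => zvar t ^ n%:Z * iter n bs f t) = (fun t => f t - taylor f n t).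
Proof.
move=> ig fK; elim: n => [|n ih].
  by apply/funext => t; rewrite expr0z mul1r /taylor /zpoly big_ord0 subr0.
apply/funext => t; have := congr1 (fun u => u t) ih.
move=> E.
have -> : iter n.+1 bs f t = zvar t ^ (-1) * (iter n bs f t - fourier_coef f n%:Z).
  by rewrite -(fourier_coef_iter_shift n ig fK).
rewrite mulrA -zvarXD (_ : n.+1%:Z + -1 = n%:Z); last by lia.
by rewrite mulrBr E /taylor /zpoly big_ord_recr /=; ring.
Qed.

Lemma L2norm_iter_shift (gamma : R -> C) n f : inner_function gamma ->
  model_space gamma f -> L2norm (iter n bs f) = L2norm (fun t => taylor f n t - f t).
Proof.
move=> ig fK; have fL := model_L2 fK.
rewrite -(L2norm_zvarX_mul n%:Z (model_L2 (iter_model_shift n ig fK))).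
by rewrite (iter_shiftE n ig fK) L2norm_distC//; exact: L2_zpoly.
Qed.

(** The N-th step costs f^(N) <psi, S^{*N} g> + <S^{*N} f, chi> conj(g^(N)). Here <psi, S^{*N} g> =
    <z^N psi, g> is the conjugate of the N-th coefficient of conj(psi) g, and <S^{*N} f, chi> is the
    N-th coefficient of conj(chi) f; the costs thus add up to pairings with Taylor polynomials. *)
Lemma shift_defect_telescope psi chi f g N : Kb psi -> Ka chi ->
  (forall f, Ka f ->
    (fun t => A f t - compressed_shift beta (A (compressed_shift_adj alpha f)) t) =
    (fun t => rank_one psi (model_kernel alpha 0) f t +
      rank_one (model_kernel beta 0) chi f t) %[ae mu]) ->
  Ka f -> Kb g -> L2 (fun t => (psi t)^* * g t) -> L2 (fun t => (chi t)^* * f t) ->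
  inner_prod (A f) g = inner_prod (A (iter N bs f)) (iter N bs g) +
    (inner_prod (taylor f N) (fun t => (psi t)^* * g t) +
     inner_prod (fun t => (chi t)^* * f t) (taylor g N)).
Proof.
move=> pK cK hyp fK gK pgL cfL.
rewrite (inner_prod_zpolyl _ _ pgL) (inner_prod_zpolyr _ _ cfL) -big_split /=.
elim: N => [|N ih]; first by rewrite big_ord0 addr0.
rewrite ih big_ord_recr /= [RHS]addrCA [LHS]addrC; congr (_ + _).
have fNK := iter_model_shift N ia fK; have gNK := iter_model_shift N ib gK.
have kK := model_kernel0 ib.
have dK := model_shift_defect fNK.
have rK : Kb (fun t => rank_one psi (model_kernel alpha 0) (iter N bs f) t +
    rank_one (model_kernel beta 0) chi (iter N bs f) t).
  by rewrite !model_kernelE /rank_one; apply: (modelD ib); exact: (modelZ ib).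
have gNL := Lb gNK.
have := inner_prod_ae (Lb dK) (Lb rK) gNL gNL (hyp _ fNK) (ae_all (fun t _ => erefl)).
rewrite inner_prod_shift_defect// inner_prod_rank_two//.
rewrite (fourier_coef_iter_shift N ia fK) (fourier_coef_iter_shift N ib gK).
have -> : inner_prod psi (iter N bs g) = (fourier_coef (fun t => (psi t)^* * g t) N%:Z)^*.
  rewrite (inner_prod_iter_shift N ib (model_H2 pK) gK) /fourier_coef.
  rewrite -inner_prodC//; last exact: L2_zvarX.
  rewrite -inner_prod_mulr; congr inner_prod; apply/funext => t; exact: mulrC.
have -> : inner_prod (iter N bs f) chi = fourier_coef (fun t => (chi t)^* * f t) N%:Z.
  have zcL : L2 (fun t => zvar t ^ N%:Z * chi t) by apply: L2_mul_zvarX; exact: La.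
  rewrite inner_prodC; [|exact: La|exact: La].
  rewrite (inner_prod_iter_shift N ia (model_H2 cK) fK) -inner_prodC//; last exact: La.
  rewrite /fourier_coef inner_prod_mulr; congr inner_prod; apply/funext => t.
  by rewrite conjCK mulrC.
move/eqP; rewrite subr_eq => /eqP ->.
by rewrite [LHS]addrC [X in _ = _ + (_ + X)]mulrC.
Qed.

Lemma shift_defect_atto : (exists psi chi : R -> C, [/\ Kb psi, Ka chi & forall f, Ka f ->
    (fun t => A f t - compressed_shift beta (A (compressed_shift_adj alpha f)) t) =
    (fun t => rank_one psi (model_kernel alpha 0) f t +
      rank_one (model_kernel beta 0) chi f t) %[ae mu]]) ->
  ATTO alpha beta A.
Proof.
move=> [psi [chi [pK cK hyp]]]; split => //.
have pL := Lb pK; have cL := La cK.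
have phiL : L2 (fun t => psi t + (chi t)^*) by apply: L2D => //; exact: L2J.
exists (fun t => psi t + (chi t)^*) => // f [fK fH].
have pfL := L2_mul_Hinfty phiL fH.
have oK := oproj_model ib pfL; have AfK := AK fK.
suff : (fun t => A f t - oproj Kb (fun t => (psi t + (chi t)^*) * f t) t) = (fun=> 0) %[ae mu].
  by apply: ae_imp => t /[apply] /eqP; rewrite subr_eq0 => /eqP.
apply: (model_eq0_infty ib (modelB ib AfK oK)) => g [gK gH].
have fL := La fK; have gL := Lb gK.
rewrite (inner_prodBl (Lb AfK) (Lb oK) gL) (inner_prod_oproj ib pfL gK).
have pgL : L2 (fun t => (psi t)^* * g t) by apply: L2_mul_Hinfty => //; exact: L2J.
have cfL : L2 (fun t => (chi t)^* * f t) by apply: L2_mul_Hinfty => //; exact: L2J.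
(* [psi] goes over to [g] while conj(chi) stays with [f], so that each pairing keeps one factor free
   to be compared with its Taylor polynomial. *)
have -> : inner_prod (fun t => (psi t + (chi t)^*) * f t) g =
    inner_prod f (fun t => (psi t)^* * g t) + inner_prod (fun t => (chi t)^* * f t) g.
  rewrite -(inner_prod_mulr psi) -inner_prodDl//; last exact: L2_mul_Hinfty.
  by congr inner_prod; apply/funext => t; rewrite mulrDl.
have [B BP] := operator_bound.
pose ef n := L2norm (fun t => taylor f n t - f t).
pose eg n := L2norm (fun t => taylor g n t - g t).
have efc : ef n @[n --> \oo] --> (0 : R) by apply: taylor_cvg; exact: (model_H2 fK).
have egc : eg n @[n --> \oo] --> (0 : R) by apply: taylor_cvg; exact: (model_H2 gK).
(* By [L2norm_iter_shift], [ef] and [eg] are also the norms of S^{*n} f and S^{*n} g: the first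
   summand bounds the term left over by the telescoping, the others the Taylor errors in the two
   pairings. *)
apply: (@eq0_normc_le _ _ (fun n => B * ef n * eg n +
  (ef n * L2norm (fun t => (psi t)^* * g t) + L2norm (fun t => (chi t)^* * f t) * eg n))).
  rewrite [X in _ --> X](_ : 0 = B * 0 * 0 + (0 * L2norm (fun t => (psi t)^* * g t) +
    L2norm (fun t => (chi t)^* * f t) * 0)); last by ring.
  apply: cvgD; last by apply: cvgD; apply: cvgM => //; exact: cvg_cst.
  by apply: cvgM => //; apply: cvgM => //; exact: cvg_cst.
apply: nearW => n.
rewrite (shift_defect_telescope n pK cK hyp fK gK pgL cfL).
have tfL : L2 (taylor f n) by exact: L2_zpoly.
have tgL : L2 (taylor g n) by exact: L2_zpoly.
set T := inner_prod (A _) _.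
have -> : T + (inner_prod (taylor f n) (fun t => (psi t)^* * g t) +
      inner_prod (fun t => (chi t)^* * f t) (taylor g n)) -
    (inner_prod f (fun t => (psi t)^* * g t) + inner_prod (fun t => (chi t)^* * f t) g) =
    T + (inner_prod (fun t => taylor f n t - f t) (fun t => (psi t)^* * g t) +
      inner_prod (fun t => (chi t)^* * f t) (fun t => taylor g n t - g t)).
  by rewrite (inner_prodBl tfL fL pgL) (inner_prodBr tgL gL cfL); ring.
apply: le_trans (le_normcD _ _) _; apply: lerD.
  have fNK := iter_model_shift n ia fK; have gNK := iter_model_shift n ib gK.
  apply: le_trans (cauchy_schwarz (Lb (AK fNK)) (Lb gNK)) _.
  rewrite (L2norm_iter_shift n ib gK) ler_wpM2r ?L2norm_ge0//.
  by apply: le_trans (BP _ fNK) _; rewrite (L2norm_iter_shift n ia fK).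
apply: le_trans (le_normcD _ _) _; apply: lerD.
  by apply: cauchy_schwarz => //; exact: L2B.
by apply: cauchy_schwarz => //; exact: L2B.
Qed.

End ShiftDefect.

Local Open Scope complex_scope.

Theorem theorem2p1 (R : realType) (alpha beta : R -> R[i])
    (A : (R -> R[i]) -> (R -> R[i])) :
  inner_function alpha -> inner_function beta ->
  bounded_operator (model_space alpha) (model_space beta) A ->
  ATTO alpha beta A <->
  exists psi chi : R -> R[i],
    [/\ model_space beta psi, model_space alpha chi &
        forall f, model_space alpha f ->
          (fun t => A f t -
             compressed_shift beta (A (compressed_shift_adj alpha f)) t) =
          (fun t => rank_one psi (model_kernel alpha 0) f t +
             rank_one (model_kernel beta 0) chi f t)
          %[ae circle_measure]].
Proof.
move=> ia ib bA; split; first exact: atto_shift_defect.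
exact: shift_defect_atto.
Qed.
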